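(* For every integer $n\ge 1$, the element $\psi_n\in A_q[0]$ is a density of integral of motion of the quantum sine-Gordon system on the lattice, that is, $V_+(\psi_n)$ and $V_-(\psi_n)$ both belong to $\mathrm{Im}(T-\mathrm{Id})$. More precisely, $$V_+(\psi_n)=0,\qquad V_-(\psi_n)=-(T-\mathrm{Id})\bigl(V_-(A_n)\bigr).$$
   Context: Let $q$ be an indeterminate. $A_q$ is the associative unital algebra over $\mathbb{C}[q,q^{-1}]$ generated by $x_i^{\pm1},y_i^{\pm1}$ ($i\in\mathbb{Z}$) with relations: for $i<j$, $x_ix_j=q\,x_jx_i$, $y_iy_j=q\,y_jy_i$, $x_iy_j=q^{-1}y_jx_i$, $y_ix_j=q^{-1}x_jy_i$; and $x_iy_i=q^{-1}y_ix_i$ for all $i$. It is an integral domain, free over $\mathbb{C}[q,q^{-1}]$ with basis the ordered monomials $\prod_{i}x_i^{\alpha_i}y_i^{\beta_i}$ with $(\alpha_i),(\beta_i)\in\mathbb{Z}^{\mathbb{Z}}$ finitely supported. It is graded by $\deg x_i=1$, $\deg y_i=-1$; $A_q[0]$ denotes the degree $0$ part. Define $V_\pm:A_q[0]\to A_q$ by $V_+(P)=\sum_{i\in\mathbb{Z}}[x_i,P]$ and $V_-(P)=\sum_{i\in\mathbb{Z}}[y_i,P]$ (ordinary commutators; for each $P$ only finitely many terms are nonzero). Let $T$ be the algebra automorphism of $A_q$ with $T(x_i)=x_{i+1}$, $T(y_i)=y_{i+1}$, and $T^{1/2}$ the algebra automorphism with $T^{1/2}(x_i)=y_i$, $T^{1/2}(y_i)=x_{i+1}$.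 $\mathrm{Im}(T-\mathrm{Id})$ denotes the image of $T-\mathrm{Id}:A_q\to A_q$. $q$-numbers: $[m]=\frac{q^m-1}{q-1}$ and $[m]!=\prod_{k=1}^m[k]$ for $m\in\mathbb{N}=\{0,1,2,\dots\}$. For $(m,p)\in\mathbb{Z}^2$, $\left[\begin{smallmatrix}m\\ p\end{smallmatrix}\right]$ equals $1$ if $p=0$; $0$ if $p<0$ or $p>\max(0,m)$; and $\frac{[m]!}{[p]!\,[m-p]!}$ if $0\le p\le m$. For integers $a_1,\dots,a_M$, $F_q(a_1,\dots,a_M)=\prod_{i=1}^{M-1}\left[\begin{smallmatrix}a_i+a_{i+1}-1\\ a_{i+1}\end{smallmatrix}\right]$. For $n\ge1$ choose any integer $N$ with $n\le 2(N-1)$, let $I_n$ be the set of $(\alpha_1,\dots,\alpha_{2N-2})\in\mathbb{N}^{2N-2}$ with $\alpha_1\geq 1$ and $\alpha_1+\dots+\alpha_{2N-2}=n$, and put $$A_n=\sum_{\underline\alpha\in I_n}\frac{[n]}{[\alpha_1]}F_q(\alpha_1,\dots,\alpha_{2N-2})\,(x_1y_1)^{-\alpha_1}(y_1x_2)^{-\alpha_2}(x_2y_2)^{-\alpha_3}\cdots(x_{N-1}y_{N-1})^{-\alpha_{2N-3}}(y_{N-1}x_N)^{-\alpha_{2N-2}},$$ $B_n=T^{1/2}(A_n)$, $\psi_n=A_n+B_n$. The coefficients lie in $\mathbb{Z}[q]$, and $A_n,\psi_n$ do not depend on the choice of $N$. *)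

(* Defs.v *)
From HB Require Import structures.
From mathcomp Require Import all_boot all_order all_algebra.
From mathcomp Require Import complex zify ring.
From mathcomp Require Import boolp classical_sets functions cardinality fsbigop.
From mathcomp Require Import reals.

Set Implicit Arguments.
Unset Strict Implicit.
Unset Printing Implicit Defensive.

Import Order.TTheory GRing.Theory Num.Theory.

Local Open Scope ring_scope.
Local Open Scope quotient_scope.

(* Everything is developed over an arbitrary field F of constants; F(q) is    *)
(* {fraction {poly F}} with q the class of the polynomial variable.            *)

Section LaurentPolynomials.
Variable F : fieldType.

Definition qfrac : {fraction {poly F}} := tofrac 'X.

Definition is_laurent : {pred {fraction {poly F}}} :=
  fun r => `[< exists (p : {poly F}) (n : nat), r = tofrac p / qfrac ^+ n >].

Lemma qfrac_neq0 : qfrac != 0.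
Proof. by rewrite tofrac_eq0 polyX_eq0. Qed.

Lemma is_laurent_poly p : tofrac p \in is_laurent.
Proof. by apply/asboolP; exists p, 0%N; rewrite expr0 divr1. Qed.

Lemma is_laurent_subring : subring_closed is_laurent.
Proof.
have q0 n : qfrac ^+ n != 0 by rewrite expf_neq0 ?qfrac_neq0.
split.
- by rewrite -tofrac1 is_laurent_poly.
- move=> _ _ /asboolP[p [m ->]] /asboolP[r [n ->]]; apply/asboolP.
  exists (p * 'X^n - r * 'X^m), (m + n)%N.
  rewrite tofracB !tofracM !tofracXn -/qfrac exprD mulrBl.
  congr (_ - _); first by rewrite invfM mulrACA divff ?q0 // mulr1.
  by rewrite (mulrC (qfrac ^+ m)) invfM mulrACA divff ?q0 // mulr1.
- move=> _ _ /asboolP[p [m ->]] /asboolP[r [n ->]]; apply/asboolP.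
  by exists (p * r), (m + n)%N; rewrite tofracM exprD invfM mulrACA.
Qed.

HB.instance Definition _ :=
  GRing.isSubringClosed.Build {fraction {poly F}} is_laurent is_laurent_subring.

(* The ring F[q, q^-1], as a subring of F(q).                                 *)
Record laurent := Laurent {
  laurent_val :> {fraction {poly F}};
  laurent_valP : laurent_val \in is_laurent }.

HB.instance Definition _ := [isSub for laurent_val].
HB.instance Definition _ := [Choice of laurent by <:].
HB.instance Definition _ := [SubChoice_isSubComNzRing of laurent by <:].

Lemma is_laurent_q : qfrac \in is_laurent.
Proof. exact: is_laurent_poly. Qed.

Lemma is_laurent_qV : qfrac^-1 \in is_laurent.
Proof. by apply/asboolP; exists 1, 1%N; rewrite tofrac1 mul1r. Qed.

Definition qL : laurent := Laurent is_laurent_q.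
Definition qLV : laurent := Laurent is_laurent_qV.

Lemma qLK : qL * qLV = 1.
Proof. by apply: val_inj; rewrite /= divff ?qfrac_neq0. Qed.

(* Evaluation at q = 1, used only to see that the algebra below is nonzero.   *)
Lemma eval1_ex (r : laurent) :
  exists c : F, exists (p : {poly F}) (n : nat),
    (r : {fraction _}) = tofrac p / qfrac ^+ n /\ c = p.[1].
Proof.
by have /asboolP[p [n rE]] := laurent_valP r; exists p.[1], p, n.
Qed.

Definition eval1 (r : laurent) : F := projT1 (cid (eval1_ex r)).

Lemma eval1E (r : laurent) (p : {poly F}) n :
  (r : {fraction _}) = tofrac p / qfrac ^+ n -> eval1 r = p.[1].
Proof.
have q0 m : qfrac ^+ m != 0 by rewrite expf_neq0 ?qfrac_neq0.
move=> rE; rewrite /eval1; case: cid => c /= [p' [n' [rE' ->]]].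
have /eqP : tofrac p / qfrac ^+ n = tofrac p' / qfrac ^+ n' by rewrite -rE -rE'.
rewrite eqr_div // -!tofracXn -!tofracM tofrac_eq => /eqP /(congr1 (horner^~ 1)).
by rewrite !hornerM !hornerXn !expr1n !mulr1.
Qed.

Lemma eval1_is_zmod_morphism : zmod_morphism eval1.
Proof.
move=> r s; have /asboolP[p [m rE]] := laurent_valP r.
have /asboolP[t [n sE]] := laurent_valP s.
have q0 k : qfrac ^+ k != 0 by rewrite expf_neq0 ?qfrac_neq0.
rewrite (eval1E rE) (eval1E sE) (@eval1E _ (p * 'X^n - t * 'X^m) (m + n)%N).
  by rewrite !hornerE !expr1n !mulr1.
rewrite /= rE sE tofracB !tofracM !tofracXn -/qfrac exprD mulrBl.
congr (_ - _); first by rewrite invfM mulrACA divff ?q0 // mulr1.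
by rewrite (mulrC (qfrac ^+ m)) invfM mulrACA divff ?q0 // mulr1.
Qed.

Lemma eval1_is_monoid_morphism : monoid_morphism eval1.
Proof.
split; first by rewrite (@eval1E _ 1 0%N) ?hornerC // expr0 divr1 tofrac1.
move=> r s; have /asboolP[p [m rE]] := laurent_valP r.
have /asboolP[t [n sE]] := laurent_valP s.
rewrite (eval1E rE) (eval1E sE) (@eval1E _ (p * t) (m + n)%N) ?hornerM //.
by rewrite /= rE sE tofracM exprD invfM mulrACA.
Qed.

HB.instance Definition _ :=
  GRing.isZmodMorphism.Build laurent F eval1 eval1_is_zmod_morphism.
HB.instance Definition _ :=
  GRing.isMonoidMorphism.Build laurent F eval1 eval1_is_monoid_morphism.

Lemma eval1_q : eval1 qL = 1.
Proof. by rewrite (@eval1E _ 'X 0%N) ?hornerX // expr0 divr1. Qed.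

Lemma eval1_qV : eval1 qLV = 1.
Proof. by rewrite (@eval1E _ 1 1%N) ?hornerC // tofrac1 mul1r. Qed.

End LaurentPolynomials.

Inductive letter := LX of int | LY of int.

Section Presentation.
Variable F : fieldType.
Local Notation L := (laurent F).

(* [qrel g h c] : the defining relation g h = c h g.                          *)
Inductive qrel : letter -> letter -> L -> Prop :=
| QrelXX (i j : int) : i < j -> qrel (LX i) (LX j) (qL F)
| QrelYY (i j : int) : i < j -> qrel (LY i) (LY j) (qL F)
| QrelXY (i j : int) : i < j -> qrel (LX i) (LY j) (qLV F)
| QrelYX (i j : int) : i < j -> qrel (LY i) (LX j) (qLV F)
| QrelXYdiag (i : int) : qrel (LX i) (LY i) (qLV F).

Inductive term :=
| Cst of L
| Gen of letter
| GenV of letter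
| Add of term & term
| Mul of term & term.

HB.instance Definition _ := gen_eqMixin term.
HB.instance Definition _ := gen_choiceMixin term.

(* The congruence generated by the axioms of unital associative F[q, q^-1]-   *)
(* algebras and the defining relations: term / eqv is the presented algebra.  *)
Inductive eqv : term -> term -> Prop :=
| EqvRefl a : eqv a a
| EqvSym a b : eqv a b -> eqv b a
| EqvTrans a b c : eqv a b -> eqv b c -> eqv a c
| EqvAdd a a' b b' : eqv a a' -> eqv b b' -> eqv (Add a b) (Add a' b')
| EqvMul a a' b b' : eqv a a' -> eqv b b' -> eqv (Mul a b) (Mul a' b')
| EqvAddA a b c : eqv (Add a (Add b c)) (Add (Add a b) c)
| EqvAddC a b : eqv (Add a b) (Add b a)
| EqvAdd0 a : eqv (Add (Cst 0) a) a
| EqvAddN a : eqv (Add (Mul (Cst (- 1)) a) a) (Cst 0)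
| EqvMulA a b c : eqv (Mul a (Mul b c)) (Mul (Mul a b) c)
| EqvMul1l a : eqv (Mul (Cst 1) a) a
| EqvMul1r a : eqv (Mul a (Cst 1)) a
| EqvMulDl a b c : eqv (Mul (Add a b) c) (Add (Mul a c) (Mul b c))
| EqvMulDr a b c : eqv (Mul a (Add b c)) (Add (Mul a b) (Mul a c))
| EqvCstD c d : eqv (Cst (c + d)) (Add (Cst c) (Cst d))
| EqvCstM c d : eqv (Cst (c * d)) (Mul (Cst c) (Cst d))
| EqvCstC c a : eqv (Mul (Cst c) a) (Mul a (Cst c))
| EqvGenK g : eqv (Mul (Gen g) (GenV g)) (Cst 1)
| EqvGenVK g : eqv (Mul (GenV g) (Gen g)) (Cst 1)
| EqvRel g h c : qrel g h c ->
    eqv (Mul (Gen g) (Gen h)) (Mul (Cst c) (Mul (Gen h) (Gen g))).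

Definition eqvb (a b : term) : bool := `[< eqv a b >].

Lemma eqvb_refl : reflexive eqvb.
Proof. by move=> a; apply/asboolP/EqvRefl. Qed.

Lemma eqvb_sym : symmetric eqvb.
Proof. by move=> a b; apply/asboolP/asboolP; apply: EqvSym. Qed.

Lemma eqvb_trans : transitive eqvb.
Proof.
by move=> b a c /asboolP ab /asboolP bc; apply/asboolP/(EqvTrans ab bc).
Qed.

Canonical eqvb_equiv := EquivRel eqvb eqvb_refl eqvb_sym eqvb_trans.

Definition Aq := {eq_quot eqvb}.
HB.instance Definition _ := Choice.on Aq.
HB.instance Definition _ := EqQuotient.on Aq.

Definition cls (a : term) : Aq := \pi_Aq a.

Lemma clsP a b : cls a = cls b <-> eqv a b.
Proof.
split=> [/eqP|ab].
  by rewrite /cls eqmodE => /asboolP.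
by apply/eqP; rewrite /cls eqmodE; apply/asboolP.
Qed.

Lemma clsK (u : Aq) : cls (repr u) = u.
Proof. exact: reprK. Qed.

Lemma reprP a : eqv (repr (cls a)) a.
Proof. by apply/clsP/clsK. Qed.

Definition Aq_add (u v : Aq) := cls (Add (repr u) (repr v)).
Definition Aq_mul (u v : Aq) := cls (Mul (repr u) (repr v)).
Definition Aq_opp (u : Aq) := cls (Mul (Cst (- 1)) (repr u)).
Definition Aq_scale (c : L) (u : Aq) := cls (Mul (Cst c) (repr u)).

Lemma clsD a b : Aq_add (cls a) (cls b) = cls (Add a b).
Proof. by apply/clsP/EqvAdd; apply: reprP. Qed.

Lemma clsM a b : Aq_mul (cls a) (cls b) = cls (Mul a b).
Proof. by apply/clsP/EqvMul; apply: reprP. Qed.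

Lemma clsN a : Aq_opp (cls a) = cls (Mul (Cst (- 1)) a).
Proof. by apply/clsP/EqvMul; [apply: EqvRefl | apply: reprP]. Qed.

Lemma clsZ c a : Aq_scale c (cls a) = cls (Mul (Cst c) a).
Proof. by apply/clsP/EqvMul; [apply: EqvRefl | apply: reprP]. Qed.

Lemma Aq_addA : associative Aq_add.
Proof.
move=> u v w; rewrite -(clsK u) -(clsK v) -(clsK w) !clsD.
exact/clsP/EqvAddA.
Qed.

Lemma Aq_addC : commutative Aq_add.
Proof. by move=> u v; apply/clsP/EqvAddC. Qed.

Lemma Aq_add0 : left_id (cls (Cst 0)) Aq_add.
Proof. by move=> u; rewrite -(clsK u) clsD; apply/clsP/EqvAdd0. Qed.

Lemma Aq_addN : left_inverse (cls (Cst 0)) Aq_opp Aq_add.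
Proof. by move=> u; rewrite -(clsK u) clsN clsD; apply/clsP/EqvAddN. Qed.

HB.instance Definition _ :=
  GRing.isZmodule.Build Aq Aq_addA Aq_addC Aq_add0 Aq_addN.

Lemma Aq_mulA : associative Aq_mul.
Proof.
move=> u v w; rewrite -(clsK u) -(clsK v) -(clsK w) !clsM.
exact/clsP/EqvMulA.
Qed.

Lemma Aq_mul1l : left_id (cls (Cst 1)) Aq_mul.
Proof. by move=> u; rewrite -(clsK u) clsM; apply/clsP/EqvMul1l. Qed.

Lemma Aq_mul1r : right_id (cls (Cst 1)) Aq_mul.
Proof. by move=> u; rewrite -(clsK u) clsM; apply/clsP/EqvMul1r. Qed.

Lemma Aq_mulDl : left_distributive Aq_mul Aq_add.
Proof.
move=> u v w; rewrite -(clsK u) -(clsK v) -(clsK w) !(clsM, clsD).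
exact/clsP/EqvMulDl.
Qed.

Lemma Aq_mulDr : right_distributive Aq_mul Aq_add.
Proof.
move=> u v w; rewrite -(clsK u) -(clsK v) -(clsK w) !(clsM, clsD).
exact/clsP/EqvMulDr.
Qed.

(* Interpretation of terms, i.e. the universal property of the presentation.  *)
Section Interpretation.
Variables (B : pzRingType) (f : {rmorphism L -> B}) (u v : letter -> B).
Hypothesis f_central : forall c b, f c * b = b * f c.
Hypothesis uK : forall g, u g * v g = 1.
Hypothesis vK : forall g, v g * u g = 1.
Hypothesis u_rel : forall g h c, qrel g h c -> u g * u h = f c * (u h * u g).

Fixpoint interp (a : term) : B :=
  match a with
  | Cst c => f c
  | Gen g => u g
  | GenV g => v g
  | Add a b => interp a + interp b
  | Mul a b => interp a * interp b
  end.

Lemma interp_eqv a b : eqv a b -> interp a = interp b.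
Proof.
elim=> {a b} //=; try by move=> *; congruence.
- by move=> *; rewrite addrA.
- by move=> *; rewrite addrC.
- by move=> a; rewrite rmorph0 add0r.
- by move=> a; rewrite rmorphN rmorph1 mulN1r addNr rmorph0.
- by move=> *; rewrite mulrA.
- by move=> a; rewrite rmorph1 mul1r.
- by move=> a; rewrite rmorph1 mulr1.
- by move=> *; rewrite mulrDl.
- by move=> *; rewrite mulrDr.
- by move=> *; rewrite rmorphD.
- by move=> *; rewrite rmorphM.
- by move=> g; rewrite rmorph1 uK.
- by move=> g; rewrite rmorph1 vK.
Qed.

Definition Aq_lift (w : Aq) : B := interp (repr w).

Lemma Aq_lift_cls a : Aq_lift (cls a) = interp a.
Proof. exact/interp_eqv/reprP. Qed.

End Interpretation.

Lemma Aq_oner_neq0 : cls (Cst 1) != 0 :> Aq.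
Proof.
have cc (c : L) (b : F) : eval1 c * b = b * eval1 c by rewrite mulrC.
have uv (g : letter) : (1 : F) * 1 = 1 by rewrite mulr1.
have rel g h c : qrel g h c -> (1 : F) * 1 = eval1 c * (1 * 1).
  by case=> *; rewrite ?eval1_q ?eval1_qV !mulr1.
have E := Aq_lift_cls cc uv uv rel.
apply/eqP => /(congr1 (Aq_lift (@eval1 F) (fun=> 1) (fun=> 1))).
rewrite [X in _ = X -> _]E E /= rmorph0 rmorph1.
by move/eqP; rewrite oner_eq0.
Qed.

HB.instance Definition _ := GRing.Zmodule_isNzRing.Build Aq
  Aq_mulA Aq_mul1l Aq_mul1r Aq_mulDl Aq_mulDr Aq_oner_neq0.

Lemma Aq_scaleA c d (u : Aq) : Aq_scale c (Aq_scale d u) = Aq_scale (c * d) u.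
Proof.
rewrite -(clsK u) !clsZ; apply/clsP/(EqvTrans (EqvMulA _ _ _)).
by apply: EqvMul; [apply/EqvSym/EqvCstM | apply: EqvRefl].
Qed.

Lemma Aq_scale1 : left_id 1 Aq_scale.
Proof. by move=> u; rewrite -(clsK u) clsZ; apply/clsP/EqvMul1l. Qed.

Lemma Aq_scaleDr : right_distributive Aq_scale +%R.
Proof.
move=> c u v; rewrite -(clsK u) -(clsK v).
by rewrite [_ + _]clsD !clsZ [RHS]clsD; apply/clsP/EqvMulDr.
Qed.

Lemma Aq_scaleDl (u : Aq) : {morph Aq_scale^~ u : c d / c + d}.
Proof.
move=> c d; rewrite -(clsK u) /= !clsZ [RHS]clsD; apply/clsP.
apply: EqvTrans (EqvMulDl _ _ _).
by apply: EqvMul; [apply: EqvCstD | apply: EqvRefl].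
Qed.

HB.instance Definition _ := GRing.Zmodule_isLmodule.Build L Aq
  Aq_scaleA Aq_scale1 Aq_scaleDr Aq_scaleDl.

Lemma Aq_scaleAl (c : L) (u v : Aq) : c *: (u * v) = (c *: u) * v.
Proof.
rewrite -(clsK u) -(clsK v) [_ * _ in LHS]clsM [LHS]clsZ.
by rewrite [_ *: _]clsZ [RHS]clsM; apply/clsP/EqvMulA.
Qed.

Lemma Aq_scaleAr (c : L) (u v : Aq) : c *: (u * v) = u * (c *: v).
Proof.
rewrite -(clsK u) -(clsK v) [_ * _ in LHS]clsM [LHS]clsZ.
rewrite [_ *: _]clsZ [RHS]clsM; apply/clsP/(EqvTrans (EqvMulA _ _ _)).
apply: EqvTrans (EqvSym (EqvMulA _ _ _)).
by apply: EqvMul; [apply: EqvCstC | apply: EqvRefl].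
Qed.

HB.instance Definition _ := GRing.Lmodule_isLalgebra.Build L Aq Aq_scaleAl.
HB.instance Definition _ := GRing.Lalgebra_isAlgebra.Build L Aq Aq_scaleAr.

Definition Aq_unit : pred Aq := fun u => `[< exists v, v * u = 1 /\ u * v = 1 >].

Definition Aq_inv (u : Aq) : Aq :=
  if pselect (exists v, v * u = 1 /\ u * v = 1) is left e then projT1 (cid e)
  else u.

Lemma Aq_mulVr : {in Aq_unit, left_inverse 1 Aq_inv *%R}.
Proof.
move=> u /asboolP Uu; rewrite /Aq_inv; case: pselect => // e.
by case: cid => v /= [].
Qed.

Lemma Aq_divrr : {in Aq_unit, right_inverse 1 Aq_inv *%R}.
Proof.
move=> u /asboolP Uu; rewrite /Aq_inv; case: pselect => // e.
by case: cid => v /= [].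
Qed.

Lemma Aq_unitP (u v : Aq) : v * u = 1 /\ u * v = 1 -> Aq_unit u.
Proof. by move=> uv; apply/asboolP; exists v. Qed.

Lemma Aq_inv_out : {in [predC Aq_unit], Aq_inv =1 id}.
Proof. by move=> u /asboolPn Uu; rewrite /Aq_inv; case: pselect. Qed.

HB.instance Definition _ := GRing.NzRing_hasMulInverse.Build Aq
  Aq_mulVr Aq_divrr Aq_unitP Aq_inv_out.

Definition gen (g : letter) : Aq := cls (Gen g).

Lemma genK g : gen g * cls (GenV g) = 1.
Proof. by rewrite [LHS]clsM; apply/clsP/EqvGenK. Qed.

Lemma genVK g : cls (GenV g) * gen g = 1.
Proof. by rewrite [LHS]clsM; apply/clsP/EqvGenVK. Qed.

Lemma gen_unit g : gen g \is a GRing.unit.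
Proof. by apply/unitrP; exists (cls (GenV g)); rewrite genK genVK. Qed.

Lemma genV g : cls (GenV g) = (gen g)^-1.
Proof. by apply: (mulrI (gen_unit g)); rewrite genK mulrV ?gen_unit. Qed.

Lemma gen_rel g h c : qrel g h c -> gen g * gen h = c *: (gen h * gen g).
Proof.
move=> ghc; rewrite [LHS]clsM [_ * _ in RHS]clsM [RHS]clsZ.
exact/clsP/EqvRel.
Qed.

Lemma cls_cst c : cls (Cst c) = c%:A.
Proof. by rewrite [RHS]clsZ; apply/clsP/EqvSym/EqvMul1r. Qed.

Lemma in_alg_central (c : L) (u : Aq) : c%:A * u = u * c%:A.
Proof. by rewrite mulr_algl mulr_algr. Qed.

(* The endomorphism induced by a substitution of the generators.              *)
Section Substitution.
Variable s : letter -> letter.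
Hypothesis s_rel : forall g h c, qrel g h c -> qrel (s g) (s h) c.

Definition subst : Aq -> Aq :=
  Aq_lift (in_alg Aq) (fun g => gen (s g)) (fun g => (gen (s g))^-1).

Lemma subst_cls a : subst (cls a) =
  interp (in_alg Aq) (fun g => gen (s g)) (fun g => (gen (s g))^-1) a.
Proof.
apply: Aq_lift_cls.
- exact: in_alg_central.
- by move=> g; rewrite mulrV ?gen_unit.
- by move=> g; rewrite mulVr ?gen_unit.
- by move=> g h c /s_rel/gen_rel ->; rewrite mulr_algl.
Qed.

Lemma subst_zmod_morphism : zmod_morphism subst.
Proof.
move=> u v; rewrite -(clsK u) -(clsK v) [- _]clsN [_ + _ in LHS]clsD.
by rewrite !subst_cls /= scaleN1r mulN1r.
Qed.

Lemma subst_monoid_morphism : monoid_morphism subst.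
Proof.
split; first by rewrite [X in subst X]/(1) subst_cls /= scale1r.
move=> u v; rewrite -(clsK u) -(clsK v) [_ * _ in LHS]clsM.
by rewrite !subst_cls.
Qed.

Lemma subst_scalable : scalable subst.
Proof.
move=> c u; rewrite -(clsK u) [_ *: _ in LHS]clsZ.
by rewrite !subst_cls /= mulr_algl.
Qed.

Lemma subst_gen g : subst (gen g) = gen (s g).
Proof. exact: subst_cls. Qed.

End Substitution.

Definition x_ (i : int) : Aq := gen (LX i).
Definition y_ (i : int) : Aq := gen (LY i).

Definition shift_letter (g : letter) : letter :=
  match g with LX i => LX (i + 1) | LY i => LY (i + 1) end.

Definition half_letter (g : letter) : letter :=
  match g with LX i => LY i | LY i => LX (i + 1) end.

Lemma shift_rel g h c : qrel g h c -> qrel (shift_letter g) (shift_letter h) c.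
Proof. by case=> *; constructor; rewrite ?ltrD2r. Qed.

Lemma half_rel g h c : qrel g h c -> qrel (half_letter g) (half_letter h) c.
Proof.
case=> [i j ij|i j ij|i j ij|i j ij|i] /=; try by constructor; rewrite ?ltrD2r.
- by constructor; rewrite ltzD1 ltW.
- have := ij; rewrite -lezD1 le_eqVlt => /orP[/eqP <-|?]; by constructor.
- by constructor; rewrite ltrDl.
Qed.

Definition T : Aq -> Aq := subst shift_letter.
Definition Thalf : Aq -> Aq := subst half_letter.

HB.instance Definition _ :=
  GRing.isZmodMorphism.Build Aq Aq T (subst_zmod_morphism shift_rel).
HB.instance Definition _ :=
  GRing.isMonoidMorphism.Build Aq Aq T (subst_monoid_morphism shift_rel).
HB.instance Definition _ :=
  GRing.isScalable.Build L Aq Aq *:%R T (subst_scalable shift_rel).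
HB.instance Definition _ :=
  GRing.isZmodMorphism.Build Aq Aq Thalf (subst_zmod_morphism half_rel).
HB.instance Definition _ :=
  GRing.isMonoidMorphism.Build Aq Aq Thalf (subst_monoid_morphism half_rel).
HB.instance Definition _ :=
  GRing.isScalable.Build L Aq Aq *:%R Thalf (subst_scalable half_rel).

Lemma T_x i : T (x_ i) = x_ (i + 1).
Proof. exact: (subst_gen shift_rel). Qed.
Lemma T_y i : T (y_ i) = y_ (i + 1).
Proof. exact: (subst_gen shift_rel). Qed.
Lemma Thalf_x i : Thalf (x_ i) = y_ i.
Proof. exact: (subst_gen half_rel). Qed.
Lemma Thalf_y i : Thalf (y_ i) = x_ (i + 1).
Proof. exact: (subst_gen half_rel). Qed.

End Presentation.

Section Grading.
Variable F : fieldType.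
Local Notation A := (Aq F).

(* [homog d P] : P is homogeneous of degree d for deg x_i = 1, deg y_i = -1.  *)
Inductive homog : int -> A -> Prop :=
| Homog0 d : homog d 0
| HomogCst c : homog 0 c%:A
| HomogX i : homog 1 (x_ F i)
| HomogXV i : homog (- 1) (x_ F i)^-1
| HomogY i : homog (- 1) (y_ F i)
| HomogYV i : homog 1 (y_ F i)^-1
| HomogD d P Q : homog d P -> homog d Q -> homog d (P + Q)
| HomogM d e P Q : homog d P -> homog e Q -> homog (d + e) (P * Q).

Definition Aq0 : set A := [set P | homog 0 P].

Definition comm (P Q : A) : A := P * Q - Q * P.

(* The sums are finitely supported for P in Aq0: finite_comm_x, finite_comm_y.*)
Definition Vplus (P : A) : A := \sum_(i \in [set: int]) comm (x_ F i) P.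
Definition Vminus (P : A) : A := \sum_(i \in [set: int]) comm (y_ F i) P.

Lemma is_laurent_qz (d : int) : qfrac F ^ d \in @is_laurent F.
Proof.
case: d => n; first by rewrite -exprnP rpredX ?is_laurent_q.
by rewrite NegzE -exprz_inv -exprnP rpredX ?is_laurent_qV.
Qed.

Definition qz (d : int) : laurent F := Laurent (is_laurent_qz d).

Lemma qzD d e : qz (d + e) = qz d * qz e.
Proof. by apply: val_inj; rewrite /= expfzDr ?qfrac_neq0. Qed.
Lemma qz0 : qz 0 = 1. Proof. exact: val_inj. Qed.
Lemma qz1 : qz 1 = qL F. Proof. exact: val_inj. Qed.
Lemma qzN1 : qz (- 1) = qLV F. Proof. exact: val_inj. Qed.

Definition qcom (u : A) (d : int) (P : A) := u * P = qz d *: (P * u).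

Lemma qcomD u d P Q : qcom u d P -> qcom u d Q -> qcom u d (P + Q).
Proof. by rewrite /qcom mulrDr mulrDl scalerDr => -> ->. Qed.

Lemma qcomM u d e P Q : qcom u d P -> qcom u e Q -> qcom u (d + e) (P * Q).
Proof.
rewrite /qcom => uP uQ; rewrite mulrA uP -scalerAl -(mulrA P u Q) uQ -scalerAr.
by rewrite scalerA -qzD mulrA.
Qed.

Lemma qcomV u d P : P \is a GRing.unit -> qcom u d P -> qcom u (- d) P^-1.
Proof.
rewrite /qcom => UP uP; apply: (mulIr UP).
rewrite -scalerAl -!mulrA mulVr // mulr1 uP -scalerAr mulrA mulVr // mul1r.
by rewrite scalerA -qzD addNr qz0 scale1r.
Qed.

Lemma qcomNr u d P : qcom u d P -> qcom P (- d) u.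
Proof. by rewrite /qcom => ->; rewrite scalerA -qzD addNr qz0 scale1r. Qed.

Lemma qcom_gen g h d : qrel g h (qz d) -> qcom (gen F g) d (gen F h).
Proof. exact: gen_rel. Qed.

Lemma qcom_homog (u : int -> A) (e : int) (Z : int -> Prop) :
  (forall j, exists N : nat, forall i, (N < `|i|)%N -> Z i ->
     qcom (u i) e (x_ F j) /\ qcom (u i) (- e) (y_ F j)) ->
  forall d P, homog d P ->
  exists N : nat, forall i, (N < `|i|)%N -> Z i -> qcom (u i) (e * d) P.
Proof.
move=> ue d P; elim=> {d P}.
- by move=> d; exists 0%N => i _ _; rewrite /qcom mulr0 mul0r scaler0.
- move=> c; exists 0%N => i _ _.
  by rewrite mulr0 /qcom qz0 scale1r in_alg_central.
- by move=> j; have [N uN] := ue j; exists N => i /uN h /h[]; rewrite mulr1.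
- move=> j; have [N uN] := ue j; exists N => i /uN h /h[xj _].
  by rewrite mulrN1; apply: qcomV xj; apply: gen_unit.
- by move=> j; have [N uN] := ue j; exists N => i /uN h /h[]; rewrite mulrN1.
- move=> j; have [N uN] := ue j; exists N => i /uN h /h[_ yj].
  by rewrite mulr1 -[e]opprK; apply: qcomV yj; apply: gen_unit.
- move=> d P Q _ [N uP] _ [M uQ]; exists (maxn N M) => i.
  by rewrite gtn_max => /andP[/uP iP /uQ iQ] Zi; apply: qcomD; auto.
- move=> d f P Q _ [N uP] _ [M uQ]; exists (maxn N M) => i.
  rewrite gtn_max => /andP[/uP iP /uQ iQ] Zi.
  by rewrite mulrDr; apply: qcomM; auto.
Qed.

Lemma finite_comm (u : int -> A) (e : int) (P : A) :
  (forall j, exists N : nat, forall i, (N < `|i|)%N -> 0 <= i ->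
     qcom (u i) e (x_ F j) /\ qcom (u i) (- e) (y_ F j)) ->
  (forall j, exists N : nat, forall i, (N < `|i|)%N -> i < 0 ->
     qcom (u i) (- e) (x_ F j) /\ qcom (u i) (- - e) (y_ F j)) ->
  Aq0 P -> finite_set [set i | comm (u i) P != 0].
Proof.
move=> /qcom_homog up /qcom_homog un P0.
have [N uN] := up _ _ P0; have [M uM] := un _ _ P0.
pose B := maxn N M.
have [s sP] : exists s : seq int, forall i : int, (`|i| <= B)%N -> i \in s.
  exists [seq (k%:Z - B%:Z) | k <- iota 0 (B + B).+1] => i iB.
  apply/mapP; exists `|(i + B%:Z)%R|%N; last by lia.
  by rewrite mem_iota; lia.
apply: (@sub_finite_set _ _ [set` s]); last exact: finite_seq.
move=> i /= ui0; have [iB|Bi] := leqP `|i|%N B; last first.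
  have [iN iM] : (N < `|i|)%N /\ (M < `|i|)%N.
    by move: Bi; rewrite gtn_max => /andP.
  move/eqP: ui0; case; rewrite /comm; apply/eqP; rewrite subr_eq0; apply/eqP.
  have [i0|i0] := leP 0 i.
    by rewrite (uN i iN i0) mulr0 qz0 scale1r.
  by rewrite (uM i iM i0) mulr0 qz0 scale1r.
exact: sP.
Qed.

Lemma finite_comm_x P : Aq0 P -> finite_set [set i | comm (x_ F i) P != 0].
Proof.
apply: (@finite_comm _ (- 1)) => j; exists `|j|%N => i ij i0; split.
- apply: qcomNr; apply: qcom_gen; rewrite qz1; constructor; lia.
- apply: qcomNr; apply: qcom_gen; rewrite qzN1; constructor; lia.
- by apply: qcom_gen; rewrite opprK qz1; constructor; lia.
- by apply: qcom_gen; rewrite !opprK qzN1; constructor; lia.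
Qed.

Lemma finite_comm_y P : Aq0 P -> finite_set [set i | comm (y_ F i) P != 0].
Proof.
apply: (@finite_comm _ 1) => j; exists `|j|%N => i ij i0; split.
- rewrite -[1]opprK; apply: qcomNr; apply: qcom_gen; rewrite qzN1; constructor.
  lia.
- apply: qcomNr; apply: qcom_gen; rewrite qz1; constructor; lia.
- by apply: qcom_gen; rewrite qzN1; constructor; lia.
- by apply: qcom_gen; rewrite opprK qz1; constructor; lia.
Qed.

Definition is_density (P : A) : Prop :=
  [/\ Aq0 P, range (fun Q : A => T Q - Q) (Vplus P)
    & range (fun Q : A => T Q - Q) (Vminus P)].

End Grading.

Section FieldIdentities.
Variable K : fieldType.
Implicit Types f P A S B t m Q G k : K.

Lemma qbin_pascal_id f P A S B t : P != 0 -> A != 0 -> S != 0 -> B != 0 ->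
  f * (A + t * B) / (P * A * (S * B)) = f / (P * (S * B)) + t * (f / (P * A * S)).
Proof. by move=> P0 A0 S0 B0; field; rewrite P0 A0 S0 B0. Qed.

Lemma qbin_shift_id f P A S m : P != 0 -> A != 0 -> S != 0 -> m != 0 ->
  A / m * (f / (P * A * S)) = f / (P * (S * m)).
Proof. by move=> P0 A0 S0 m0; field; rewrite P0 A0 S0 m0. Qed.

Lemma coef_id k m B Q G : m != 0 -> B != 0 ->
  k / m * (Q * G) = B / m * Q * (k / B * G).
Proof. by move=> m0 B0; field; rewrite m0 B0. Qed.

End FieldIdentities.

Section Densities.
Variable F : fieldType.
Local Notation Fq := {fraction {poly F}}.

Definition qnum (m : nat) : Fq := (qfrac F ^+ m - 1) / (qfrac F - 1).

Definition qfact (m : nat) : Fq := \prod_(1 <= k < m.+1) qnum k.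

Definition qbin (m p : int) : Fq :=
  if p == 0 then 1
  else if (p < 0) || (Num.max 0 m < p) then 0
  else qfact `|m| / (qfact `|p| * qfact `|(m - p)%R|).

Definition F_q (a : seq int) : Fq :=
  \prod_(i < (size a).-1) qbin (a`_i + a`_i.+1 - 1) a`_i.+1.

Definition coefA (n : nat) (a : seq nat) : Fq :=
  qnum n / qnum (head 0%N a) * F_q [seq k%:Z | k <- a].

(* The quotients above are all polynomials in q: qbin_poly, coefA_poly.       *)
Definition is_qpoly : {pred Fq} := fun r => `[< exists p : {poly F}, r = tofrac p >].

Lemma qfrac_neq1 : qfrac F - 1 != 0.
Proof. by rewrite -tofrac1 -tofracB tofrac_eq0 polyXsubC_eq0. Qed.

Lemma qfracX_neq1 m : (0 < m)%N -> qfrac F ^+ m - 1 != 0.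
Proof.
move=> m0; rewrite -tofracXn -tofrac1 -tofracB tofrac_eq0 -size_poly_eq0.
by rewrite size_XnsubC.
Qed.

Lemma qnum_neq0 m : (0 < m)%N -> qnum m != 0.
Proof.
by move=> m0; apply: mulf_neq0 (qfracX_neq1 m0) (invr_neq0 qfrac_neq1).
Qed.

Lemma qnum0 : qnum 0 = 0.
Proof. by rewrite /qnum expr0 subrr mul0r. Qed.

Lemma qnumD m p : qnum (m + p) = qnum m + qfrac F ^+ m * qnum p.
Proof.
rewrite /qnum mulrA -mulrDl exprD mulrBr mulr1; congr (_ / _).
by rewrite [RHS]addrC addrA subrK.
Qed.

Lemma is_qpoly_semiring : semiring_closed is_qpoly.
Proof.
split; split.
- by apply/asboolP; exists 0; rewrite tofrac0.
- move=> _ _ /asboolP[p ->] /asboolP[r ->].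
  by apply/asboolP; exists (p + r); rewrite tofracD.
- by apply/asboolP; exists 1; rewrite tofrac1.
- move=> _ _ /asboolP[p ->] /asboolP[r ->].
  by apply/asboolP; exists (p * r); rewrite tofracM.
Qed.

HB.instance Definition _ :=
  GRing.isSemiringClosed.Build Fq is_qpoly is_qpoly_semiring.

Lemma is_qpoly_q : qfrac F \in is_qpoly.
Proof. by apply/asboolP; exists 'X. Qed.

Lemma is_qpoly_num m : qnum m \in is_qpoly.
Proof.
elim: m => [|m IH]; first by rewrite qnum0 rpred0.
have q1 : qnum 1 = 1 by rewrite /qnum expr1 divff ?qfrac_neq1.
by rewrite -addn1 qnumD q1 mulr1 rpredD // rpredX ?is_qpoly_q.
Qed.

Lemma qfact0 : qfact 0 = 1.
Proof. by rewrite /qfact big_nil. Qed.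

Lemma qfactS m : qfact m.+1 = qfact m * qnum m.+1.
Proof. by rewrite /qfact big_nat_recr. Qed.

Lemma qfact_neq0 m : qfact m != 0.
Proof.
elim: m => [|m IH]; first by rewrite qfact0 oner_neq0.
by rewrite qfactS mulf_neq0 ?qnum_neq0.
Qed.

Lemma qbin_nat_poly m p :
  (p <= m)%N -> qfact m / (qfact p * qfact (m - p)) \in is_qpoly.
Proof.
elim: m p => [|m IH] [|p] pm //; rewrite ?subn0 ?qfact0 ?mul1r ?divff
  ?qfact_neq0 ?oner_neq0 ?rpred1 // ?invr1 ?rpred1 //.
move: pm; rewrite ltnS subSS leq_eqVlt => /orP[/eqP ->|pm].
  by rewrite subnn qfact0 mulr1 divff ?qfact_neq0 ?rpred1.
have E : (m - p = (m - p.+1).+1)%N by lia.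
have -> : qfact m.+1 / (qfact p.+1 * qfact (m - p)) =
    qfact m / (qfact p * qfact (m - p)) +
    qfrac F ^+ p.+1 * (qfact m / (qfact p.+1 * qfact (m - p.+1))).
  rewrite E !qfactS -E (_ : m.+1 = p.+1 + (m - p))%N; last by lia.
  by rewrite qnumD qbin_pascal_id ?qfact_neq0 ?qnum_neq0 //; lia.
apply: rpredD; first by apply: IH; rewrite ltnW.
by apply: rpredM; [rewrite rpredX ?is_qpoly_q | apply: IH].
Qed.

Lemma qbin_poly m p : qbin m p \in is_qpoly.
Proof.
rewrite /qbin; case: eqP => [|p0]; first by rewrite rpred1.
case: ifPn; rewrite ?rpred0 // negb_or -!leNgt => /andP[p_ge0].
rewrite le_max => /orP[|pm]; first by move=> ?; case: p0; lia.
have -> : `|(m - p)%R|%N = (`|m| - `|p|)%N by lia.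
by apply: qbin_nat_poly; lia.
Qed.

Lemma F_q_poly a : F_q a \in is_qpoly.
Proof. by apply: rpred_prod => i _; apply: qbin_poly. Qed.

Lemma F_q_cons a b s : F_q [:: a, b & s] = qbin (a + b - 1) b * F_q (b :: s).
Proof. by rewrite /F_q /= big_ord_recl. Qed.

(* [m + p - 1 choose p] [p] / [m] = [m + p - 1 choose p - 1]                  *)
Lemma qbin_shift (m p : nat) : (0 < m)%N ->
  qnum p / qnum m * qbin (m%:Z + p%:Z - 1) p%:Z \in is_qpoly.
Proof.
move=> m0; case: p => [|p]; first by rewrite qnum0 !mul0r rpred0.
have -> : qbin (m%:Z + p.+1%:Z - 1) p.+1%:Z =
    qfact (m + p) / (qfact p.+1 * qfact m.-1).
  rewrite /qbin /= ifF; last by lia.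
  by congr (qfact _ / (_ * qfact _)); lia.
have -> : qnum p.+1 / qnum m * (qfact (m + p) / (qfact p.+1 * qfact m.-1)) =
    qfact (m + p) / (qfact p * qfact (m + p - p)).
  have -> : qfact (m + p - p) = qfact m.-1 * qnum m.
    by rewrite addnK -{1}(prednK m0) qfactS prednK.
  by rewrite qfactS qbin_shift_id ?qfact_neq0 ?qnum_neq0.
by apply: qbin_nat_poly; lia.
Qed.

Lemma F_q_0 (s : seq nat) k : k \in s -> (0 < k)%N ->
  F_q [seq j%:Z | j <- 0%N :: s] = 0.
Proof.
elim: s => // b s IH; rewrite inE => kbs k0; rewrite /= F_q_cons.
case: b kbs => [|b] kbs.
  rewrite [X in _ * X](IH _ k0) ?mulr0 //.
  by case/orP: kbs k0 => // /eqP ->.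
by rewrite /qbin /= ifT ?mul0r //; lia.
Qed.

Lemma coef_F_q_poly (k a : nat) (s : seq nat) : (0 < a)%N ->
  k \in a :: s -> qnum k / qnum a * F_q [seq j%:Z | j <- a :: s] \in is_qpoly.
Proof.
move=> a0; elim: s a a0 => [|b s IH] a a0.
  by rewrite inE => /eqP ->; rewrite divff ?qnum_neq0 // mul1r F_q_poly.
rewrite inE => /orP[/eqP ->|kbs].
  by rewrite divff ?qnum_neq0 // mul1r F_q_poly.
case: (posnP k) => [->|k0]; first by rewrite qnum0 !mul0r rpred0.
rewrite /= F_q_cons; have [b0|b0] := posnP b.
  have ks : k \in s by move: kbs; rewrite b0 inE => /orP[/eqP|//]; lia.
  by rewrite b0 [X in _ * (_ * X)](F_q_0 ks k0) !mulr0 rpred0.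
have -> : qnum k / qnum a *
    (qbin (a%:Z + b%:Z - 1) b * F_q (b%:Z :: [seq j%:Z | j <- s])) =
  (qnum b / qnum a * qbin (a%:Z + b%:Z - 1) b) *
  (qnum k / qnum b * F_q [seq j%:Z | j <- b :: s]).
  by rewrite /= (@coef_id _ _ _ (qnum b)) ?qnum_neq0.
by rewrite rpredM ?qbin_shift ?IH.
Qed.

Lemma coefA_poly n (a : seq nat) : sumn a = n -> coefA n a \in is_qpoly.
Proof.
move=> <-; rewrite /coefA; have [a0|a0] := posnP (head 0%N a).
  by rewrite a0 qnum0 invr0 mulr0 mul0r rpred0.
suff: forall b : seq nat, {subset b <= a} ->
    qnum (sumn b) / qnum (head 0%N a) * F_q [seq k%:Z | k <- a] \in is_qpoly.
  exact.
elim=> [|k b IH] ba; first by rewrite /= qnum0 !mul0r rpred0.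
rewrite /= qnumD !mulrDl rpredD //.
  case: a a0 ba {IH} => // c s c0 ba.
  by apply: coef_F_q_poly => //; apply: ba; rewrite inE eqxx.
rewrite -!mulrA rpredM ?rpredX ?is_qpoly_q // !mulrA IH // => j jb.
by apply: ba; rewrite inE jb orbT.
Qed.

(* [coefA n a] as an element of F[q, q^-1]; the default value 0 is not used   *)
(* when a sums to n, see val_coefL.                                           *)
Definition coefL (n : nat) (a : seq nat) : laurent F :=
  insubd (0 : laurent F) (coefA n a).

Lemma val_coefL n (a : seq nat) : sumn a = n -> val (coefL n a) = coefA n a.
Proof.
move=> /coefA_poly /asboolP[p pE]; rewrite val_insubd pE.
by rewrite is_laurent_poly.
Qed.

(* The k-th factor base, k counted from 0: x_1 y_1, y_1 x_2, x_2 y_2, ...     *)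
Definition xy_pair (k : nat) : Aq F :=
  if odd k then y_ F (k./2 + 1)%N * x_ F (k./2 + 2)%N
  else x_ F (k./2 + 1)%N * y_ F (k./2 + 1)%N.

Definition monomA (a : seq nat) : Aq F :=
  \prod_(k < size a) xy_pair k ^- nth 0%N a k.

(* The entries of an element of I_n are at most n, so that I_n is encoded by  *)
(* tuples over 'I_n.+1.                                                       *)
Definition exps (n : nat) (a : seq 'I_n) : seq nat := [seq val i | i <- a].

Definition I_ (n N : nat) : {set (2 * N - 2).-tuple 'I_n.+1} :=
  [set a : (2 * N - 2).-tuple 'I_n.+1 |
     (0 < head 0%N (exps a))%N && (sumn (exps a) == n)]%SET.

Definition A_ (n N : nat) : Aq F :=
  \sum_(a in I_ n N) coefL n (exps a) *: monomA (exps a).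

Definition B_ (n N : nat) : Aq F := Thalf (A_ n N).

Definition psi_ (n N : nat) : Aq F := A_ n N + B_ n N.

Lemma Aq0_A n N : Aq0 (A_ n N).
Proof.
have homogZ (c : laurent F) (P : Aq F) : homog 0 P -> homog 0 (c *: P).
  by move=> P0; rewrite -mulr_algl -[0]addr0; apply: HomogM P0; apply: HomogCst.
have homog1 : homog 0 (1 : Aq F) by rewrite -[1]scale1r; apply: HomogCst.
have xyV i j : homog 0 (x_ F i * y_ F j)^-1.
  rewrite invrM ?gen_unit // -[0]/(1 + -1 : int).
  by apply: HomogM; [apply: HomogYV | apply: HomogXV].
have yxV i j : homog 0 (y_ F i * x_ F j)^-1.
  rewrite invrM ?gen_unit // -[0]/(-1 + 1 : int).
  by apply: HomogM; [apply: HomogXV | apply: HomogYV].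
rewrite /Aq0 /= /A_; elim/big_ind: _ => [|P Q|a _]; first exact: Homog0.
  exact: HomogD.
apply: homogZ; rewrite /monomA; elim/big_ind: _ => // [P Q P0 Q0|k _].
  by rewrite -[0]addr0; apply: HomogM.
rewrite -exprVn; elim: (nth _ _ _) => // m IH.
rewrite exprS -[0]addr0; apply: HomogM IH.
by rewrite /xy_pair; case: odd.
Qed.

End Densities.

(* Main.v *)
Require Import Defs.
From mathcomp Require Import all_boot all_order all_algebra.
From mathcomp Require Import complex zify ring.
From mathcomp Require Import boolp classical_sets functions cardinality fsbigop.
From mathcomp Require Import reals.

Set Implicit Arguments.
Unset Strict Implicit.
Unset Printing Implicit Defensive.

Import Order.TTheory GRing.Theory Num.Theory.

Local Open Scope ring_scope.

(** Write the generators x_1, y_1, x_2, y_2, ... as z_0, z_1, z_2, ... and put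
    u_k = (z_k z_(k+1))^-1, so that A_n is a combination of the monomials
    u_0^a0 u_1^a1 ... and T^(1/2) maps z_k to z_(k+1) and u_k to u_(k+1).

    Since T^(1/2) exchanges the x_i and the y_i up to a shift, it intertwines
    V_+ and V_- ([Vminus_Thalf], [Vplus_Thalf]), and its square is T ([ThalfK]).
    So everything follows from V_+(A_n) + V_+(B_n) = 0 ([Vplus_A_B]): then
    V_-(B_n) = T^(1/2) V_+(A_n) = - T^(1/2) V_+(B_n) = - T V_-(A_n).

    The reason for this cancellation is a continued fraction. Let
    f_k = u_k (1 - f_(k+1))^-1, as a series in the u_j. As
    f_(k+1) u_k = q u_k f_(k+1), the q-binomial theorem gives
      f_k^a = u_k^a (sum over b of [a+b-1 choose b] f_(k+1)^b),
    so the coefficients F_q are those of the powers of f_0, and A_n is [n] times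
    the part of degree n of the q-logarithm sum_(a >= 1) f_0^a / [a]; likewise
    B_n with f_1. As a sum of inner derivations, V_+ is a derivation, and it acts
    on the f_k in closed form:
      V_+(f_k^a) = [a] (q - 1) (f_k^a - f_k^(a+1)) z_k    for k even,
      V_+(f_k^a) = [a] (1 - q) z_k^-1 f_k^(a-1)           for k odd.
    Each of the two at k + 1 implies the other at k; the step to an odd k uses
    the two Pascal rules for the Gaussian coefficients. After division by [a],
    the sum over a telescopes for k = 0 to
      (q - 1) f_0 z_0 = (q - 1) z_1^-1 (1 - f_1)^-1,
    and for k = 1 it is the geometric series (1 - q) z_1^-1 (1 - f_1)^-1: they
    cancel.

    Below, [fpow] stands for the homogeneous parts of f_k^a and [flog] for those
    of [n] f_k^a / [a], in finitely many letters. As [a] has no inverse in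
    F[q, q^-1], [flog] and the quotient [fder] of V_+(f_k^a) by [a] are given by
    division-free recursions; [Vplus_fpow] and [Vplus_flog] relate them, and
    [fderE] is the closed form above. *)

(** * Gaussian coefficients in the Laurent polynomials *)

Section GaussianCoefficients.
Variable F : fieldType.
Local Notation q := (qL F).

Definition qint (m : nat) : laurent F := \sum_(i < m) q ^+ i.

(** The row of index a.+1 of [qmulti], from the row of index a and the weight
    w = q^a of the Pascal rule [qmultiSS]. *)
Fixpoint qmulti_row (row : nat -> laurent F) (w : laurent F) (b : nat) : laurent F :=
  if b is b'.+1 then row b + w * qmulti_row row w b' else 1.

(** The Gaussian coefficient [a+b-1 choose b], the coefficient of t^b in
    1 / ((1-t) (1-qt) ... (1 - q^(a-1) t)). It vanishes for a = 0 < b, which is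
    the convention of [qbin]. *)
Fixpoint qmulti (a : nat) : nat -> laurent F :=
  if a is a'.+1 then qmulti_row (qmulti a') (q ^+ a')
  else fun b => (b == 0%N)%:R.

Lemma qmulti_n0 a : qmulti a 0 = 1.
Proof. by case: a. Qed.

Lemma qmulti_0S b : qmulti 0 b.+1 = 0.
Proof. by []. Qed.

Lemma qmultiSS a b :
  qmulti a.+1 b.+1 = qmulti a b.+1 + q ^+ a * qmulti a.+1 b.
Proof. by []. Qed.

Lemma qmulti_1n b : qmulti 1 b = 1.
Proof.
by elim: b => // b IH; rewrite qmultiSS IH expr0 mulr1 qmulti_0S add0r.
Qed.

Lemma qint0 : qint 0 = 0.
Proof. by rewrite /qint big_ord0. Qed.

Lemma qintD m p : qint (m + p) = qint m + q ^+ m * qint p.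
Proof.
rewrite /qint big_split_ord /= mulr_sumr; congr (_ + _).
by apply: eq_bigr => i _; rewrite exprD.
Qed.

Lemma qintE m : qint m * (q - 1) = q ^+ m - 1.
Proof. by rewrite /qint subrX1 mulrC. Qed.

Lemma val_laurentD (r s : laurent F) : val (r + s) = val r + val s.
Proof. by []. Qed.

Lemma val_laurentM (r s : laurent F) : val (r * s) = val r * val s.
Proof. by []. Qed.

Lemma val_laurent_qX m : val (q ^+ m) = qfrac F ^+ m.
Proof. by elim: m => // m IH; rewrite !exprS val_laurentM IH. Qed.

Lemma val_qint m : val (qint m) = qnum F m.
Proof.
apply: (mulIf (qfrac_neq1 F)); rewrite divfK ?qfrac_neq1 //.
by have /(congr1 val) := qintE m; rewrite val_laurentM !val_laurentD val_laurent_qX.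
Qed.

Lemma qfact_qmulti a b :
  val (qmulti a.+1 b) * (qfact F a * qfact F b) = qfact F (a + b).
Proof.
elim: a b => [|a IHa] b; first by rewrite qmulti_1n qfact0 !mul1r.
elim: b => [|b IHb]; first by rewrite qmulti_n0 qfact0 addn0 mulr1 mul1r.
have -> : qfact F (a.+1 + b.+1) =
    qfact F (a + b.+1) * (qnum F a.+1 + qfrac F ^+ a.+1 * qnum F b.+1).
  by rewrite -qnumD addSn qfactS.
rewrite mulrDr -{1}IHa -addSnnS -IHb qmultiSS val_laurentD val_laurentM val_laurent_qX.
rewrite (qfactS F a) (qfactS F b); ring.
Qed.

Lemma qmulti_sym a b : qmulti a.+1 b = qmulti b.+1 a.
Proof.
apply: val_inj; apply: (@mulIf _ (qfact F a * qfact F b)).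
  by rewrite mulf_neq0 ?qfact_neq0.
by rewrite qfact_qmulti mulrC addnC -qfact_qmulti mulrC [_ * qfact F b]mulrC.
Qed.

(** The other Pascal rule, obtained from the first one by the symmetry
    [a+b choose b] = [a+b choose a]. *)
Lemma qmultiSSl a b :
  qmulti a.+1 b.+1 = qmulti a.+1 b + q ^+ b.+1 * qmulti a b.+1.
Proof.
case: a => [|a]; first by rewrite !qmulti_1n qmulti_0S mulr0 addr0.
by rewrite qmulti_sym qmultiSS -!(qmulti_sym _ b) -!(qmulti_sym _ b.+1).
Qed.

(** The absorption identity, which replaces every division by [a]. *)
Lemma qint_qmulti a b :
  qmulti a b.+1 * qint b.+1 = qint a * qmulti a.+1 b.
Proof.
case: a => [|a]; first by rewrite qmulti_0S qint0 !mul0r.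
apply: val_inj; apply: (@mulIf _ (qfact F a * qfact F b)).
  by rewrite mulf_neq0 ?qfact_neq0.
rewrite !val_laurentM !val_qint.
have := qfact_qmulti a b.+1; have := qfact_qmulti a.+1 b.
rewrite addnS addSn !qfactS => <- /eqP; rewrite -subr_eq0 => /eqP E.
apply/eqP; rewrite -subr_eq0 -E; apply/eqP; ring.
Qed.

Lemma val_qmulti (a b : nat) : val (qmulti a b) = qbin F (a%:Z + b%:Z - 1) b%:Z.
Proof.
case: b => [|b]; first by rewrite qmulti_n0.
case: a => [|a]; first by rewrite qmulti_0S /qbin /= ifT //; lia.
rewrite /qbin ifF; last by lia.
apply: (@mulIf _ (qfact F a * qfact F b.+1)).
  by rewrite mulf_neq0 ?qfact_neq0.
rewrite qfact_qmulti.
have -> : `|(a.+1%:Z + b.+1%:Z - 1)%R|%N = (a + b.+1)%N by lia.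
have -> : `|(a.+1%:Z + b.+1%:Z - 1 - b.+1%:Z)%R|%N = a by lia.
by rewrite [qfact F b.+1 * _]mulrC divfK // mulf_neq0 ?qfact_neq0.
Qed.

End GaussianCoefficients.
Arguments qmulti : simpl never.

(** * The derivations V_+ and V_- of the degree zero part *)

Section Commutators.
Variable F : fieldType.
Local Notation A := (Aq F).
Implicit Types P Q : A.

Lemma commDr P Q Q' : comm P (Q + Q') = comm P Q + comm P Q'.
Proof. by rewrite /comm mulrDr mulrDl opprD addrACA. Qed.

Lemma commZr P c Q : comm P (c *: Q) = c *: comm P Q.
Proof. by rewrite /comm -scalerAl -scalerAr scalerBr. Qed.

Lemma commMr P Q Q' : comm P (Q * Q') = comm P Q * Q' + Q * comm P Q'.
Proof. by rewrite /comm mulrBl mulrBr !mulrA addrA subrK. Qed.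

Lemma finite_supp_seq (f : int -> A) :
  finite_set [set i | f i != 0]%classic ->
  exists2 r : seq int, uniq r & forall i, i \notin r -> f i = 0.
Proof.
move=> /finite_seqP[r rE]; exists (undup r); first exact: undup_uniq.
move=> i; rewrite mem_undup => /negP ir; apply/eqP; apply: contrapT => /negP fi.
by apply: ir; have : [set` r]%classic i by rewrite -rE.
Qed.

Lemma fsum_seq (f : int -> A) (r : seq int) : uniq r ->
  (forall i, i \notin r -> f i = 0) ->
  \sum_(i \in [set: int]) f i = \sum_(i <- r) f i.
Proof.
move=> Ur f0; rewrite (fsbigE r) => [||//|i _]; [|exact: Ur|exact: f0].
by under eq_bigl do rewrite in_setT.
Qed.

Lemma fsum_seq2 (f g : int -> A) :
  finite_set [set i | f i != 0]%classic -> finite_set [set i | g i != 0]%classic ->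
  exists r : seq int, [/\ uniq r, forall i, i \notin r -> f i = 0
    & forall i, i \notin r -> g i = 0].
Proof.
move=> /finite_supp_seq[r Ur fr] /finite_supp_seq[s Us gs].
exists (undup (r ++ s)); split; first exact: undup_uniq.
- by move=> i; rewrite mem_undup mem_cat negb_or => /andP[/fr].
- by move=> i; rewrite mem_undup mem_cat negb_or => /andP[_ /gs].
Qed.

Lemma fsumD (f g : int -> A) :
  finite_set [set i | f i != 0]%classic -> finite_set [set i | g i != 0]%classic ->
  \sum_(i \in [set: int]) (f i + g i) =
  \sum_(i \in [set: int]) f i + \sum_(i \in [set: int]) g i.
Proof.
move=> ff fg; have [r [Ur fr gr]] := fsum_seq2 ff fg.
rewrite (fsum_seq Ur fr) (fsum_seq Ur gr) -big_split (@fsum_seq _ r) //.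
by move=> i ir; rewrite fr // gr // addr0.
Qed.

Lemma VplusD P Q : Aq0 P -> Aq0 Q -> Vplus (P + Q) = Vplus P + Vplus Q.
Proof.
move=> P0 Q0; rewrite /Vplus -fsumD; [|exact: finite_comm_x|exact: finite_comm_x].
by apply: eq_fsbigr => i _; rewrite commDr.
Qed.

Lemma VminusD P Q : Aq0 P -> Aq0 Q -> Vminus (P + Q) = Vminus P + Vminus Q.
Proof.
move=> P0 Q0; rewrite /Vminus -fsumD; [|exact: finite_comm_y|exact: finite_comm_y].
by apply: eq_fsbigr => i _; rewrite commDr.
Qed.

(** Each summand of V_+ is an inner derivation; over the union of the supports
    for P and Q the sum is finite. *)
Lemma VplusM P Q : Aq0 P -> Aq0 Q ->
  Vplus (P * Q) = Vplus P * Q + P * Vplus Q.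
Proof.
move=> /finite_comm_x fP /finite_comm_x fQ.
have [r [Ur Pr Qr]] := fsum_seq2 fP fQ.
rewrite /Vplus (fsum_seq Ur Pr) (fsum_seq Ur Qr) mulr_suml mulr_sumr -big_split /=.
rewrite (@fsum_seq _ r) //; last first.
  by move=> i ir; rewrite commMr Pr // Qr // mul0r mulr0 addr0.
by apply: eq_bigr => i _; rewrite commMr.
Qed.

Lemma VplusZ c P : Aq0 P -> Vplus (c *: P) = c *: Vplus P.
Proof.
move=> /finite_comm_x /finite_supp_seq[r Ur Pr].
rewrite /Vplus (fsum_seq Ur Pr) scaler_sumr (@fsum_seq _ r) //.
  by apply: eq_bigr => i _; rewrite commZr.
by move=> i ir; rewrite commZr Pr // scaler0.
Qed.

Lemma Vplus1 P j : (forall i, i != j -> comm (x_ F i) P = 0) ->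
  Vplus P = comm (x_ F j) P.
Proof.
move=> Pj; rewrite /Vplus (@fsum_seq _ [:: j]) ?big_seq1 // => i.
by rewrite inE => /Pj.
Qed.

Lemma Aq0D P Q : Aq0 P -> Aq0 Q -> Aq0 (P + Q).
Proof. exact: HomogD. Qed.

Lemma Aq0M P Q : Aq0 P -> Aq0 Q -> Aq0 (P * Q).
Proof. by move=> P0 Q0; have := HomogM P0 Q0. Qed.

Lemma Aq0_cst c : Aq0 (c%:A : A).
Proof. exact: HomogCst. Qed.

Lemma Aq0Z c P : Aq0 P -> Aq0 (c *: P).
Proof. by rewrite -mulr_algl; apply/Aq0M/Aq0_cst. Qed.

Lemma Aq0_1 : Aq0 (1 : A).
Proof. by rewrite -[1]scale1r; apply: Aq0_cst. Qed.

Lemma Aq0_0 : Aq0 (0 : A).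
Proof. exact: Homog0. Qed.

Lemma Aq0X P m : Aq0 P -> Aq0 (P ^+ m).
Proof.
by move=> P0; elim: m => [|m IH]; [exact: Aq0_1 | rewrite exprS; apply: Aq0M].
Qed.

Lemma Aq0_sum I (r : seq I) (f : I -> A) :
  (forall i, Aq0 (f i)) -> Aq0 (\sum_(i <- r) f i).
Proof. by move=> f0; elim/big_ind: _ => // [|P Q]; [exact: Aq0_0 | exact: Aq0D]. Qed.

Lemma Vplus0 : Vplus (0 : A) = 0.
Proof.
by rewrite -[X in Vplus X](scale0r (0 : A)) VplusZ ?scale0r //; apply: Aq0_0.
Qed.

Lemma Vplus_sum I (r : seq I) (f : I -> A) : (forall i, Aq0 (f i)) ->
  Vplus (\sum_(i <- r) f i) = \sum_(i <- r) Vplus (f i).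
Proof.
move=> f0; elim: r => [|i r IH]; first by rewrite !big_nil Vplus0.
by rewrite !big_cons VplusD ?IH //; apply: Aq0_sum.
Qed.

Lemma homog_Thalf d P : homog d P -> homog (- d) (Thalf P).
Proof.
elim=> {d P}.
- by move=> d; rewrite raddf0; apply: Homog0.
- by move=> c; rewrite linearZ /= rmorph1 oppr0; apply: HomogCst.
- by move=> i; rewrite Thalf_x; apply: HomogY.
- move=> i; rewrite rmorphV ?gen_unit //= Thalf_x opprK; apply: HomogYV.
- by move=> i; rewrite Thalf_y opprK; apply: HomogX.
- move=> i; rewrite rmorphV ?gen_unit //= Thalf_y; apply: HomogXV.
- by move=> d P Q _ IP _ IQ; rewrite rmorphD; apply: HomogD.
- by move=> d e P Q _ IP _ IQ; rewrite rmorphM opprD; apply: HomogM.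
Qed.

Lemma Aq0_Thalf P : Aq0 P -> Aq0 (Thalf P).
Proof. by move=> /homog_Thalf; rewrite oppr0. Qed.

Lemma Thalf_comm P Q : Thalf (comm P Q) = comm (Thalf P) (Thalf Q).
Proof. by rewrite /comm rmorphB !rmorphM. Qed.

Lemma Vminus_Thalf P : Aq0 P -> Vminus (Thalf P) = Thalf (Vplus P).
Proof.
move=> /finite_comm_x /finite_supp_seq[r Ur Pr].
rewrite /Vminus /Vplus (fsum_seq Ur Pr) raddf_sum (@fsum_seq _ r) //.
  by apply: eq_bigr => i _ /=; rewrite Thalf_comm Thalf_x.
by move=> i ir; rewrite -Thalf_x -Thalf_comm Pr // raddf0.
Qed.

Lemma Vplus_Thalf P : Aq0 P -> Vplus (Thalf P) = Thalf (Vminus P).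
Proof.
have bS : bijective (fun i : int => i + 1).
  by exists (fun i => i - 1) => i; rewrite ?addrK ?subrK.
move=> /finite_comm_y /finite_supp_seq[r Ur Pr].
rewrite /Vplus (reindex_fsbigT _ _ bS) /Vminus (fsum_seq Ur Pr) raddf_sum.
rewrite (@fsum_seq _ r) //.
  by apply: eq_bigr => i _ /=; rewrite Thalf_comm Thalf_y.
by move=> i ir; rewrite -Thalf_y -Thalf_comm Pr // raddf0.
Qed.

(** Both sides are algebra morphisms that agree on the generators. *)
Lemma ThalfK P : Thalf (Thalf P) = T P.
Proof.
rewrite -(clsK P); elim: (repr P) => [c|g|g|a IHa b IHb|a IHa b IHb].
- by rewrite cls_cst !linearZ /= !rmorph1.
- rewrite -[cls _]/(gen F g); case: g => i.
    by rewrite -/(x_ F i) Thalf_x Thalf_y T_x.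
  by rewrite -/(y_ F i) Thalf_y Thalf_x T_y.
- rewrite genV; case: g => i; rewrite -/(x_ F i) -/(y_ F i).
    by rewrite !rmorphV //= ?Thalf_x ?gen_unit // Thalf_y T_x.
  by rewrite !rmorphV //= ?Thalf_y ?gen_unit // Thalf_x T_y.
- by rewrite -clsD !raddfD /= IHa IHb.
- by rewrite -clsM !rmorphM /= IHa IHb.
Qed.

End Commutators.

(** * The letters z_k and the elements u_k *)

Section Lattice.
Variable F : fieldType.
Local Notation A := (Aq F).
Local Notation q := (qL F).

(** The position of a letter in the order ..., x_i, y_i, x_(i+1), ...; together
    with the sign, it gives all the defining relations in the one formula of
    [qcom_letter_lt]. *)
Definition letter_pos (g : letter) : int :=
  match g with LX i => i + i | LY i => i + i + 1 end.

Definition letter_sign (g : letter) : int :=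
  match g with LX _ => 1 | LY _ => -1 end.

Lemma qcom_letter_lt g h : letter_pos g < letter_pos h ->
  qcom (gen F g) (letter_sign g * letter_sign h) (gen F h).
Proof.
case: g h => [i|i] [j|j] /= ij; apply: qcom_gen.
- by rewrite mulr1 qz1; constructor; lia.
- rewrite mul1r qzN1; have [->|ij'] := eqVneq i j; first exact: QrelXYdiag.
  by apply: QrelXY; lia.
- by rewrite mulr1 qzN1; constructor; lia.
- by rewrite mulrNN mulr1 qz1; constructor; lia.
Qed.

Lemma qcom_letter_gt g h : letter_pos h < letter_pos g ->
  qcom (gen F g) (- (letter_sign g * letter_sign h)) (gen F h).
Proof. by move=> /qcom_letter_lt; rewrite mulrC => /qcomNr. Qed.

(** Index 0 is x_1, in agreement with the numbering of [xy_pair]. *)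
Definition z_letter (k : nat) : letter :=
  if odd k then LY (k./2 + 1)%N else LX (k./2 + 1)%N.

Definition z_ (k : nat) : A := gen F (z_letter k).

Definition u_ (k : nat) : A := (xy_pair F k)^-1.

Lemma letter_pos_z k : letter_pos (z_letter k) = k.+2%:Z.
Proof. by rewrite /z_letter; case: ifP => ok /=; lia. Qed.

Lemma letter_sign_zS k : letter_sign (z_letter k.+1) = - letter_sign (z_letter k).
Proof. by rewrite /z_letter /=; case: odd. Qed.

Lemma letter_sign_sq g : letter_sign g * letter_sign g = 1.
Proof. by case: g. Qed.

Lemma xy_pairE k : xy_pair F k = z_ k * z_ k.+1.
Proof.
rewrite /xy_pair /z_ /z_letter /=; case: ifP => ok /=; rewrite /x_ /y_.
  by congr (gen _ _ * gen _ (LX _%:Z)); lia.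
by congr (gen _ _ * gen _ (LY _%:Z)); lia.
Qed.

Lemma z_unit k : z_ k \is a GRing.unit. Proof. exact: gen_unit. Qed.
Hint Resolve z_unit : core.

Lemma u_E k : u_ k = (z_ k.+1)^-1 * (z_ k)^-1.
Proof. by rewrite /u_ xy_pairE invrM. Qed.

Lemma u_z k : u_ k * z_ k = (z_ k.+1)^-1.
Proof. by rewrite u_E mulrVK. Qed.

Lemma z_u k : z_ k.+1 * u_ k = (z_ k)^-1.
Proof. by rewrite u_E mulVKr. Qed.

Lemma qcom_pair w d e k : qcom w d (z_ k) -> qcom w e (z_ k.+1) ->
  qcom w (- (d + e)) (u_ k).
Proof.
move=> wk wSk; rewrite /u_; apply: qcomV; last by rewrite xy_pairE; apply: qcomM.
by rewrite xy_pairE unitrMl.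
Qed.

Lemma qcom_refl P : qcom P 0 (P : A).
Proof. by rewrite /qcom qz0 scale1r. Qed.

Lemma qcom0P (P Q : A) : qcom P 0 Q <-> comm P Q = 0.
Proof.
rewrite /qcom /comm qz0 scale1r; split=> [->|/eqP]; first by rewrite subrr.
by rewrite subr_eq0 => /eqP.
Qed.

Lemma qcom_z_u k : qcom (z_ k) 1 (u_ k).
Proof.
have zz : qcom (z_ k) (-1) (z_ k.+1).
  have := @qcom_letter_lt (z_letter k) (z_letter k.+1).
  rewrite !letter_pos_z letter_sign_zS mulrN letter_sign_sq; apply; lia.
by have := qcom_pair (qcom_refl (z_ k)) zz; rewrite add0r opprK.
Qed.

Lemma qcom_zS_u k : qcom (z_ k.+1) (-1) (u_ k).
Proof.
have zz : qcom (z_ k.+1) 1 (z_ k).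
  have := @qcom_letter_gt (z_letter k.+1) (z_letter k).
  rewrite !letter_pos_z letter_sign_zS mulNr letter_sign_sq opprK; apply; lia.
by have := qcom_pair zz (qcom_refl (z_ k.+1)); rewrite addr0.
Qed.

(** A letter outside the pair z_k, z_(k+1) lies on the same side of both, and
    these have opposite signs. *)
Lemma qcom_far_u g k :
  (letter_pos g < k.+2%:Z) || (k.+3%:Z < letter_pos g) -> qcom (gen F g) 0 (u_ k).
Proof.
case/orP=> gk.
  have gSk : letter_pos g < k.+3%:Z by lia.
  rewrite -letter_pos_z in gk; rewrite -letter_pos_z in gSk.
  have := qcom_pair (qcom_letter_lt gk) (qcom_letter_lt gSk).
  by rewrite letter_sign_zS mulrN subrr oppr0.
have gSk : k.+2%:Z < letter_pos g by lia.
rewrite -letter_pos_z in gk; rewrite -letter_pos_z in gSk.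
have := qcom_pair (qcom_letter_gt gSk) (qcom_letter_gt gk).
by rewrite letter_sign_zS mulrN opprK addNr oppr0.
Qed.

Lemma qcomX (w P : A) d m : qcom w d P -> qcom w (d * m%:Z) (P ^+ m).
Proof.
move=> wP; elim: m => [|m IH].
  by rewrite mulr0 /qcom qz0 expr0 mulr1 mul1r scale1r.
by rewrite exprS intS mulrDr mulr1; apply: qcomM.
Qed.

Lemma qcom_cst (w : A) c : qcom w 0 (c%:A : A).
Proof. by rewrite /qcom qz0 scale1r in_alg_central. Qed.

Lemma qcomZ (w P : A) d c : qcom w d P -> qcom w d (c *: P).
Proof.
by rewrite /qcom => wP; rewrite -scalerAr -scalerAl wP scalerA mulrC -scalerA.
Qed.

Lemma qcom_0 (w : A) d : qcom w d 0.
Proof. by rewrite /qcom mulr0 mul0r scaler0. Qed.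

Lemma qcom_sum (w : A) d I (r : seq I) (f : I -> A) :
  (forall i, qcom w d (f i)) -> qcom w d (\sum_(i <- r) f i).
Proof.
by move=> wf; elim/big_ind: _ => // [|P Q]; [exact: qcom_0 | exact: qcomD].
Qed.

Lemma Aq0_u k : Aq0 (u_ k).
Proof.
rewrite u_E /z_ /z_letter /=; case: odd => /=.
  by have := HomogM (HomogXV F (uphalf k + 1)%N) (HomogYV F (k./2 + 1)%N).
by have := HomogM (HomogYV F (uphalf k + 1)%N) (HomogXV F (k./2 + 1)%N).
Qed.

Lemma Thalf_z k : Thalf (z_ k) = z_ k.+1.
Proof.
rewrite /z_ /z_letter /=; case: ifP => ok /=.
  by rewrite [LHS]Thalf_y; congr (gen _ (LX _)); lia.
by rewrite [LHS]Thalf_x; congr (gen _ (LY _%:Z)); lia.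
Qed.

Lemma Thalf_u k : Thalf (u_ k) = u_ k.+1.
Proof.
rewrite !u_E rmorphM /= !rmorphV ?z_unit //=.
by rewrite !Thalf_z.
Qed.

Lemma qz_nat m : qz F m%:Z = q ^+ m.
Proof. by apply: val_inj; rewrite val_laurent_qX. Qed.

(** The quotient of V_+(u_k^a) by [a]: among the x_i, only the even one of z_k and
    z_(k+1) fails to commute with u_k. *)
Definition v_ (k a : nat) : A :=
  if odd k then (1 - q) *: ((z_ k)^-1 * u_ k ^+ a.-1)
  else (q - 1) *: (u_ k ^+ a * z_ k).

Lemma Vplus_uX k a : Vplus (u_ k ^+ a) = qint F a *: v_ k a.
Proof.
case: a => [|a].
  rewrite expr0 qint0 scale0r /Vplus (@fsum_seq _ _ [::]) ?big_nil // => i _.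
  by rewrite /comm mulr1 mul1r subrr.
rewrite /v_; case: ifP => ok; rewrite scalerA.
  pose j : int := (k./2 + 2)%N.
  have zj : z_ k.+1 = x_ F j.
    by rewrite /z_ /z_letter /= ok; congr (gen _ (LX _%:Z)); lia.
  rewrite (@Vplus1 _ _ j) -?zj; last first.
    move=> i ij; apply/qcom0P; rewrite -(mul0r (a.+1%:Z)); apply: qcomX.
    by apply: qcom_far_u => /=; rewrite /j in ij; lia.
  have := qcomNr (qcomX a.+1 (qcom_zS_u k)); rewrite mulN1r opprK.
  rewrite /qcom /comm => ->; rewrite -[X in X - _]scale1r -scalerBl.
  rewrite qz_nat [u_ k ^+ _]exprS mulrA z_u.
  congr (_ *: _); rewrite -[1 - q]opprB mulrN qintE; ring.
pose j : int := (k./2 + 1)%N.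
have zj : z_ k = x_ F j by rewrite /z_ /z_letter ok.
rewrite (@Vplus1 _ _ j) -?zj; last first.
  move=> i ij; apply/qcom0P; rewrite -(mul0r (a.+1%:Z)); apply: qcomX.
  by apply: qcom_far_u => /=; rewrite /j in ij; lia.
have := qcomX a.+1 (qcom_z_u k); rewrite mul1r /qcom /comm => ->.
by rewrite qz_nat -[X in _ - X]scale1r -scalerBl qintE.
Qed.

End Lattice.

(** * Powers of the continued fraction *)

Section Recursion.
Variable F : fieldType.
Local Notation A := (Aq F).
Local Notation q := (qL F).
Local Notation u := (@u_ F).
Local Notation z := (@z_ F).
Local Notation C := (@qmulti F).
Local Notation qi := (@qint F).

(** The part of degree r of sum_b [a+b-1 choose b] f_k^b, in the m letters u_k,
    ..., u_(k+m-1). *)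
Fixpoint ftail (m k a r : nat) : A :=
  if m is m'.+1 then
    \sum_(b < r.+1) C a b *: (u k ^+ b * ftail m' k.+1 b (r - b))
  else (r == 0%N)%:R.

(** The part of degree a + r of f_k^a, in the m + 1 letters u_k, ..., u_(k+m). *)
Definition fpow m k a r : A := u k ^+ a * ftail m k.+1 a r.

(** The element [a+r] / [a] times [fpow], see [qint_flog]. The recursion comes
    from [a+r] = [a] + q^a [r] and the absorption identity, which turns
    [a+b-1 choose b] / [a] into [a+b-1 choose b-1] / [b]; the index of summation
    is b - 1. *)
Fixpoint flog (m k a r : nat) : A :=
  fpow m k a r +
  if m is m'.+1 then
    q ^+ a *: (u k ^+ a *
      \sum_(b < r) C a.+1 b *: flog m' k.+1 b.+1 (r - b.+1))
  else 0.

(** The quotient of V_+(f_k^a) by [a], by the Leibniz rule and the same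
    absorption. *)
Fixpoint fder (m k a r : nat) : A :=
  v_ F k a * ftail m k.+1 a r +
  if m is m'.+1 then
    u k ^+ a * \sum_(b < r) C a.+1 b *: fder m' k.+1 b.+1 (r - b.+1)
  else 0.

Lemma ftailS m k a r :
  ftail m.+1 k a r = \sum_(b < r.+1) C a b *: fpow m k b (r - b).
Proof. by []. Qed.

Lemma flogS m k a r : flog m.+1 k a r =
  fpow m.+1 k a r + q ^+ a *: (u k ^+ a *
    \sum_(b < r) C a.+1 b *: flog m k.+1 b.+1 (r - b.+1)).
Proof. by []. Qed.

Lemma fderS m k a r : fder m.+1 k a r =
  v_ F k a * ftail m.+1 k.+1 a r +
  u k ^+ a * \sum_(b < r) C a.+1 b *: fder m k.+1 b.+1 (r - b.+1).
Proof. by []. Qed.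

Lemma ftail_a0 m k r : ftail m k 0 r = (r == 0%N)%:R.
Proof.
elim: m k r => // m IH k r; rewrite ftailS big_ord_recl big1 => [|b _]; last first.
  by rewrite scale0r.
by rewrite addr0 qmulti_n0 scale1r subn0 /fpow expr0 mul1r IH.
Qed.

Lemma ftail_recl m k a r : ftail m.+1 k a r =
  (r == 0%N)%:R + \sum_(b < r) C a b.+1 *: fpow m k b.+1 (r - b.+1).
Proof.
by rewrite ftailS big_ord_recl qmulti_n0 scale1r subn0 {1}/fpow ftail_a0 mul1r.
Qed.

Lemma Aq0_nat m : Aq0 (m%:R : A).
Proof. by rewrite -(scaler_nat m (1 : A)); apply: Aq0_cst. Qed.

Lemma Aq0_ftail m k a r : Aq0 (ftail m k a r).
Proof.
elim: m k a r => [|m IH] k a r; first exact: Aq0_nat.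
by apply: Aq0_sum => b; apply/Aq0Z/Aq0M => //; apply/Aq0X/Aq0_u.
Qed.

Lemma Aq0_fpow m k a r : Aq0 (fpow m k a r).
Proof. by apply: Aq0M; [exact/Aq0X/Aq0_u | exact: Aq0_ftail]. Qed.

Lemma Aq0_flog m k a r : Aq0 (flog m k a r).
Proof.
elim: m k a r => [|m IH] k a r; apply: Aq0D; try exact: Aq0_fpow.
  exact: Aq0_0.
apply/Aq0Z/Aq0M; first exact/Aq0X/Aq0_u.
by apply: Aq0_sum => b; apply/Aq0Z/IH.
Qed.

Lemma Vplus_nat m : Vplus (m%:R : A) = 0.
Proof.
rewrite /Vplus (@fsum_seq _ _ [::]) ?big_nil // => i _.
by rewrite /comm mulr_natl mulr_natr subrr.
Qed.

Lemma Vplus_fpow m k a r : Vplus (fpow m k a r) = qi a *: fder m k a r.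
Proof.
elim: m k a r => [|m IH] k a r; rewrite VplusM ?Vplus_uX;
  try exact: Aq0_ftail; try exact/Aq0X/Aq0_u.
  by rewrite Vplus_nat mulr0 /= !addr0 scalerAl.
rewrite ftail_recl VplusD ?Vplus_nat ?add0r; last 2 first.
- exact: Aq0_nat.
- by apply: Aq0_sum => b; apply/Aq0Z/Aq0_fpow.
rewrite Vplus_sum => [|b]; last exact/Aq0Z/Aq0_fpow.
rewrite -ftail_recl /= scalerDr scalerAl; congr (_ + _).
rewrite scalerAr scaler_sumr; congr (_ * _); apply: eq_bigr => b _.
by rewrite VplusZ ?IH ?scalerA ?qint_qmulti //; apply: Aq0_fpow.
Qed.

Lemma qint_flog m k a r : qi a *: flog m k a r = qi (a + r) *: fpow m k a r.
Proof.
elim: m k a r => [|m IH] k a r.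
  rewrite /= addr0 /fpow /=; case: r => [|r]; first by rewrite addn0.
  by rewrite mulr0 !scaler0.
rewrite flogS qintD scalerDr scalerDl; congr (_ + _).
rewrite -scalerA scalerA mulrC -scalerA; congr (_ *: _).
rewrite scalerAr [RHS]scalerAr ftail_recl; congr (_ * _).
rewrite scalerDr [X in _ = X + _](_ : _ = 0); last first.
  by case: (r) => [|?]; rewrite ?qint0 ?scale0r ?scaler0.
rewrite add0r !scaler_sumr; apply: eq_bigr => b _.
rewrite scalerA -qint_qmulti -scalerA IH !scalerA mulrC.
by rewrite subnKC.
Qed.

(** Morally [qint_flog] and [Vplus_fpow] combined, with a factor [a] cancelled;
    the cancellation is justified by induction, following the recursions. *)
Lemma Vplus_flog m k a r :
  Vplus (flog m k a r) = qi (a + r) *: fder m k a r.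
Proof.
elim: m k a r => [|m IH] k a r.
  rewrite /= !addr0 Vplus_fpow /=; case: r => [|r]; first by rewrite addn0 addr0.
  by rewrite mulr0 addr0 !scaler0.
rewrite flogS fderS.
have S0 : Aq0 (\sum_(b < r) C a.+1 b *: flog m k.+1 b.+1 (r - b.+1)).
  by apply: Aq0_sum => b; apply/Aq0Z/Aq0_flog.
have U0 : Aq0 (u k ^+ a) by apply/Aq0X/Aq0_u.
rewrite VplusD; [|exact: Aq0_fpow|by apply/Aq0Z/Aq0M].
rewrite Vplus_fpow VplusZ; last exact: Aq0M.
rewrite VplusM // Vplus_uX Vplus_sum; last by move=> b; apply/Aq0Z/Aq0_flog.
rewrite qintD [RHS]scalerDl; congr (_ + _).
rewrite -[RHS]scalerA; congr (_ *: _).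
rewrite scalerDr; congr (_ + _).
  rewrite -scalerAl scalerAr scalerAr; congr (_ * _).
  rewrite ftail_recl scalerDr [X in _ = X + _](_ : _ = 0); last first.
    by case: (r) => [|?]; rewrite ?qint0 ?scale0r ?scaler0.
  rewrite add0r !scaler_sumr; apply: eq_bigr => b _.
  rewrite scalerA -qint_qmulti -scalerA qint_flog !scalerA mulrC.
  by rewrite subnKC.
rewrite scalerAr scaler_sumr; congr (_ * _); apply: eq_bigr => b _.
rewrite VplusZ ?IH ?scalerA; last exact: Aq0_flog.
by rewrite mulrC subnKC.
Qed.

Lemma qcom_z_ftail m j k a r : (j < k)%N -> qcom (z j) 0 (ftail m k a r).
Proof.
elim: m k a r => [|m IH] k a r jk.
  by rewrite /= -(scaler_nat (r == 0%N) (1 : A)); apply: qcom_cst.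
apply: qcom_sum => b; apply: qcomZ; rewrite -[0]addr0; apply: qcomM; last first.
  by apply: IH; rewrite ltnW.
rewrite -(mul0r (b%:Z)); apply: qcomX; apply: qcom_far_u.
by rewrite letter_pos_z; apply/orP; left; lia.
Qed.

Lemma qcom_z_fpow m k a r : qcom (z k) a%:Z (fpow m k a r).
Proof.
rewrite -[a%:Z]addr0; apply: qcomM; last exact: qcom_z_ftail.
by rewrite -[a%:Z]mul1r; apply/qcomX/qcom_z_u.
Qed.

Lemma z_ftail m k a r : z k * ftail m k.+1 a r = ftail m k.+1 a r * z k.
Proof. by have := qcom_z_ftail m a r (ltnSn k); rewrite /qcom qz0 scale1r. Qed.

(** Summation by parts, for the differences f_(k+1)^b - f_(k+1)^(b+1) that the
    closed form at an even k + 1 puts into the recursion of [fder] at k. *)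
Lemma abel_sum (c d : nat -> laurent F) (s : nat -> A) r :
  c 0%N = d 0%N -> (forall b, c b.+1 = c b + d b.+1) ->
  \sum_(b < r.+1) c b *: (s b - s b.+1) =
  \sum_(b < r.+1) d b *: s b - c r *: s r.+1.
Proof.
move=> c0 cS; elim: r => [|r IH]; first by rewrite !big_ord1 c0 scalerBr.
rewrite big_ord_recr IH [in RHS]big_ord_recr /= cS scalerBr !scalerDl.
by rewrite addrA; congr (_ - _); rewrite -addrA addKr.
Qed.

(** The two closed forms of V_+(f_k^a) / [a], in degree a + r. For k even, the
    part of f_k^(a+1) in that degree is [fpow m k a.+1 (r - 1)], absent when
    r = 0; for k odd, a.+1 is the exponent. *)
Definition fder_spec m k a r : Prop :=
  if odd k then fder m k a.+1 r = (1 - q) *: ((z k)^-1 * fpow m k a r)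
  else fder m k a r =
    (q - 1) *: ((fpow m k a r - if r is r'.+1 then fpow m k a.+1 r' else 0) * z k).

(** The parity alternates along the induction on the number of letters. The
    condition r <= m ensures that no monomial of the part considered is lost by
    truncation: the nonzero exponents in a monomial of f_k^a are consecutive. *)
Lemma fderE m k a r : (r <= m)%N -> fder_spec m k a r.
Proof.
elim: m k a r => [|m IH] k a r rm; rewrite /fder_spec.
  move: rm; rewrite leqn0 => /eqP ->; rewrite /fpow /= /v_.
  by case: ifP => ok; rewrite ok !mulr1 addr0 ?subr0.
case: ifP => ok.
  rewrite fderS /v_ ok -pred_Sn.
  (* f_(k+1)^b in its part of degree r, extended by 0 to all b, so that the even
     case at k+1 reads as a difference of consecutive terms *)
  pose s b : A := if (b <= r)%N then fpow m k.+1 b (r - b) else 0.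
  under eq_bigr => b _.
    have rb : (r - b.+1 <= m)%N by lia.
    have := IH k.+1 b.+1 _ rb; rewrite /fder_spec /= ok /= => ->.
    have -> : fpow m k.+1 b.+1 (r - b.+1) = s b.+1 by rewrite /s ltn_ord.
    have -> : (if (r - b.+1)%N is r'.+1 then fpow m k.+1 b.+2 r' else 0) = s b.+2.
      rewrite /s; case: ltnP => br; last by rewrite (_ : r - b.+1 = 0)%N //; lia.
      by rewrite (_ : r - b.+1 = (r - b.+2).+1)%N //; lia.
    rewrite scalerA mulrC -scalerA scalerAl; over.
  rewrite -scaler_sumr -mulr_suml -scalerAr -[q - 1]opprB scaleNr -scalerAl -scalerBr.
  congr (_ *: _); rewrite /fpow [RHS]mulrA; apply/eqP; rewrite subr_eq addrC -subr_eq.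
  rewrite -mulrBr; apply/eqP.
  have -> : ftail m.+1 k.+1 a.+1 r - ftail m.+1 k.+1 a r =
      \sum_(b < r) (q ^+ a * C a.+1 b) *: s b.+1.
    rewrite !ftail_recl opprD addrACA subrr add0r -sumrB; apply: eq_bigr => b _.
    by rewrite -scalerBl qmultiSS addrAC subrr add0r /s ltn_ord.
  case: r => [|r] in rm s *; first by rewrite !big_ord0 mulr0 mul0r mulr0.
  (* The left-hand side has the differences of the first Pascal rule, and
     summation by parts produces those of the second one. *)
  rewrite (@abel_sum (C a.+2) (fun b => q ^+ b * C a.+1 b) (fun b => s b.+1)); first last.
  - by move=> b; rewrite qmultiSSl.
  - by rewrite !qmulti_n0 mul1r.
  rewrite [s r.+2]/s ltnn scaler0 subr0 mulr_suml !mulr_sumr; apply: eq_bigr => b _.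
  (* It remains to move z_(k+1) through u_k^(a+1) f_(k+1)^(b+1), which costs the
     power b - a of q. *)
  have sz : qcom (z k.+1) b.+1%:Z (s b.+1) by rewrite /s ltn_ord; apply: qcom_z_fpow.
  have uz : qcom (z k.+1) (- 1 * a.+1%:Z) (u k ^+ a.+1) by apply/qcomX/qcom_zS_u.
  rewrite -z_u -[_ * u k * _]mulrA -exprS -scalerAl -!scalerAr.
  have := qcomM uz sz; rewrite /qcom !mulrA => ->; rewrite scalerA.
  congr (_ *: _); rewrite mulrAC; congr (_ * _).
  rewrite -!qz_nat -qzD; congr (qz F _); lia.
rewrite fderS /v_ ok -scalerAl -mulrA z_ftail mulrA -/(fpow m.+1 k a r).
rewrite mulrBl [RHS]scalerBr; congr (_ + _).
case: r rm => [|r] rm; first by rewrite big_ord0 mulr0 mul0r scaler0 oppr0.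
rewrite -scaleNr opprB.
under eq_bigr => b _.
  have rb : (r.+1 - b.+1 <= m)%N by rewrite subSS; lia.
  have := IH k.+1 b _ rb; rewrite /fder_spec /= ok /= => ->.
  rewrite scalerA mulrC -scalerA subSS scalerAr; over.
rewrite -scaler_sumr -mulr_sumr -ftailS -scalerAr; congr (_ *: _).
by rewrite -u_z /fpow exprSr -!mulrA z_ftail.
Qed.

End Recursion.

(** * Independence of the number of letters, and the half shift *)

Section Truncation.
Variable F : fieldType.
Local Notation A := (Aq F).
Local Notation q := (qL F).
Local Notation u := (@u_ F).
Local Notation z := (@z_ F).
Local Notation C := (@qmulti F).
Local Notation qi := (@qint F).

Lemma ftail_stable m k a r : (r <= m)%N -> ftail F m.+1 k a r = ftail F m k a r.
Proof.
elim: m k a r => [|m IH] k a r rm.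
  move: rm; rewrite leqn0 => /eqP ->.
  by rewrite ftail_recl big_ord0 addr0.
rewrite ftail_recl [RHS]ftail_recl; congr (_ + _); apply: eq_bigr => b _.
by rewrite /fpow IH //; lia.
Qed.

Lemma Thalf_ftail m k a r : Thalf (ftail F m k a r) = ftail F m k.+1 a r.
Proof.
elim: m k a r => [|m IH] k a r; first by rewrite /= rmorph_nat.
rewrite /= raddf_sum; apply: eq_bigr => b _ /=.
by rewrite linearZ rmorphM rmorphXn /= Thalf_u IH.
Qed.

Lemma Thalf_fpow m k a r : Thalf (fpow F m k a r) = fpow F m k.+1 a r.
Proof. by rewrite /fpow rmorphM rmorphXn /= Thalf_u Thalf_ftail. Qed.

Lemma Thalf_flog m k a r : Thalf (flog F m k a r) = flog F m k.+1 a r.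
Proof.
elim: m k a r => [|m IH] k a r; first by rewrite /= !addr0 Thalf_fpow.
rewrite !flogS rmorphD /= Thalf_fpow linearZ rmorphM rmorphXn raddf_sum /=.
rewrite Thalf_u; congr (_ + _ *: (_ * _)); apply: eq_bigr => b _.
by rewrite linearZ /= IH.
Qed.

End Truncation.

(** * The densities as sums over exponent tuples *)

Section TupleSums.
Variable F : fieldType.
Local Notation A := (Aq F).
Local Notation q := (qL F).
Local Notation u := (@u_ F).
Local Notation C := (@qmulti F).

Lemma sum_tuple0 (V : nmodType) n r (f : seq nat -> V) :
  \sum_(s : 0.-tuple 'I_n.+1 | sumn (exps s) == r) f (exps s) =
  if r == 0%N then f [::] else 0.
Proof.
case: eqP => [->|/eqP r0].
  rewrite (big_pred1 [tuple]) // => s.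
  by rewrite (tuple0 s) [RHS]eqxx.
rewrite big_pred0 // => s; rewrite (tuple0 s) /=.
by apply/negbTE; rewrite eq_sym.
Qed.

Lemma sum_tupleS (V : nmodType) n m r (f : seq nat -> V) : (r <= n)%N ->
  \sum_(s : m.+1.-tuple 'I_n.+1 | sumn (exps s) == r) f (exps s) =
  \sum_(b < r.+1)
    \sum_(s : m.-tuple 'I_n.+1 | sumn (exps s) == (r - b)%N) f ((b : nat) :: exps s).
Proof.
move=> rn.
rewrite (reindex (fun p : 'I_n.+1 * m.-tuple 'I_n.+1 => cons_tuple p.1 p.2)) /=; last first.
  exists (fun s => (thead s, behead_tuple s)) => [[b s] _|s _] /=.
    by congr (_, _); apply: val_inj.
  by rewrite [RHS]tuple_eta; apply: val_inj.
transitivity (\sum_(b : 'I_n.+1)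
    \sum_(s : m.-tuple 'I_n.+1 | sumn (exps (cons_tuple b s)) == r)
      f (exps (cons_tuple b s))).
  by rewrite pair_big_dep.
rewrite (big_ord_widen n.+1 (fun b =>
  \sum_(s : m.-tuple 'I_n.+1 | sumn (exps s) == (r - b)%N) f ((b : nat) :: exps s))) //.
rewrite [RHS]big_mkcond; apply: eq_bigr => b _ /=; case: ifP => br.
  by apply: eq_bigl => s; rewrite /= -/(exps s); lia.
by rewrite big_pred0 // => s; rewrite /= -/(exps s); lia.
Qed.

(** The value of F_q on a :: s, as a Laurent polynomial, see [val_chain]. *)
Fixpoint chain (a : nat) (s : seq nat) : laurent F :=
  if s is b :: s' then C a b * chain b s' else 1.

Fixpoint umonom (k : nat) (s : seq nat) : A :=
  if s is b :: s' then u k ^+ b * umonom k.+1 s' else 1.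

(** The coefficient [n] / [a] F_q(a :: s) of A_n, by the recursion of [flog]. When
    the head of s vanishes, so does F_q unless all of s does, and then n = a. *)
Fixpoint wchain (a : nat) (s : seq nat) : laurent F :=
  chain a s +
  if s is b'.+1 :: s' then q ^+ a * (C a.+1 b' * wchain b'.+1 s') else 0.

Lemma monomA_u (s : seq nat) : monomA F s = umonom 0 s.
Proof.
rewrite /monomA.
suff H k : \prod_(i < size s) xy_pair F (k + i) ^- nth 0%N s i = umonom k s.
  by rewrite -H.
elim: s k => [|b s IH] k; first by rewrite big_ord0.
rewrite big_ord_recl /= addn0 -exprVn -/(u k) -IH; congr (_ * _).
by apply: eq_bigr => i _; rewrite /bump /= add1n addSnnS.
Qed.

Lemma sum_chain n m k a r : (r <= n)%N ->
  \sum_(s : m.-tuple 'I_n.+1 | sumn (exps s) == r)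
    chain a (exps s) *: umonom k (exps s) = ftail F m k a r.
Proof.
elim: m k a r => [|m IH] k a r rn.
  rewrite (sum_tuple0 n r (fun s => chain a s *: umonom k s)) /= scale1r.
  by case: eqP.
rewrite (sum_tupleS m (fun s => chain a s *: umonom k s) rn) ftailS.
apply: eq_bigr => b _; rewrite /fpow -IH ?mulr_sumr ?scaler_sumr; last by lia.
by apply: eq_bigr => s _ /=; rewrite -scalerAr scalerA.
Qed.

Lemma sum_wchain n m k a r : (r <= n)%N ->
  \sum_(s : m.-tuple 'I_n.+1 | sumn (exps s) == r)
    wchain a (exps s) *: umonom k (a :: exps s) = flog F m k a r.
Proof.
elim: m k a r => [|m IH] k a r rn.
  rewrite (sum_tuple0 n r (fun s => wchain a s *: umonom k (a :: s))) /= addr0 scale1r.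
  by rewrite addr0 /fpow /=; case: eqP; rewrite ?mulr0.
pose g s : laurent F :=
  if s is b'.+1 :: s' then q ^+ a * (C a.+1 b' * wchain b'.+1 s') else 0.
have wE s : wchain a s = chain a s + g s by case: s.
under eq_bigr do rewrite wE scalerDl.
rewrite big_split flogS; congr (_ + _).
  rewrite /fpow -(sum_chain m.+1 k.+1 a rn) mulr_sumr.
  by apply: eq_bigr => s _ /=; rewrite scalerAr.
rewrite (sum_tupleS m (fun s => g s *: umonom k (a :: s)) rn).
rewrite big_ord_recl big1 ?add0r => [|s _]; last by rewrite /= scale0r.
rewrite mulr_sumr scaler_sumr; apply: eq_bigr => b _.
rewrite -IH ?scaler_sumr ?mulr_sumr ?scaler_sumr; last by rewrite /bump /=; lia.
apply: eq_bigr => s _ /=; rewrite /bump /= add1n.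
by rewrite -!scalerAr !scalerA mulrA.
Qed.

Lemma chain0 s : chain 0 s = (sumn s == 0%N)%:R.
Proof.
elim: s => [//|[|b] s IH] /=; first by rewrite qmulti_n0 mul1r IH.
by rewrite qmulti_0S mul0r.
Qed.

Lemma val_chain a s : val (chain a s) = F_q F [seq k%:Z | k <- a :: s].
Proof.
elim: s a => [|b s IH] a; first by rewrite /F_q big_ord0.
by rewrite [chain _ _]/= val_laurentM IH val_qmulti /= F_q_cons.
Qed.

Lemma wchain_id (K : fieldType) (c d t x y w : K) : w != 0 -> y != 0 ->
  c * d + t * (c * y / w * (x / y * d)) = (w + t * x) / w * (c * d).
Proof. by move=> w0 y0; field; rewrite w0 y0. Qed.

Lemma val_wchain a s : (0 < a)%N ->
  val (wchain a s) = coefA F (a + sumn s) (a :: s).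
Proof.
elim: s a => [|b s IH] a a0; rewrite /coefA [head _ _]/= -val_chain.
  by rewrite /= addr0 addn0 divff ?qnum_neq0 // mulr1.
case: b => [|b].
  rewrite /= addr0 chain0 add0n; case: (sumn s) => [|r].
    by rewrite addn0 divff ?qnum_neq0 // mul1r.
  by rewrite /= mulr0 mulr0.
have -> : wchain a (b.+1 :: s) =
  C a b.+1 * chain b.+1 s + q ^+ a * (C a.+1 b * wchain b.+1 s) by [].
have -> : chain a (b.+1 :: s) = C a b.+1 * chain b.+1 s by [].
rewrite val_laurentD !val_laurentM val_laurent_qX IH // /coefA [head _ _]/=.
rewrite -val_chain [sumn (_ :: _)]/= (qnumD F a).
have /(congr1 val) := qint_qmulti F a b; rewrite !val_laurentM !val_qint => E.
have -> : val (C a.+1 b) = val (C a b.+1) * qnum F b.+1 / qnum F a.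
  by rewrite E mulrAC divff ?mul1r ?qnum_neq0.
by rewrite wchain_id ?qnum_neq0.
Qed.

Lemma coefL_wchain n a s : (0 < a)%N -> (a + sumn s)%N = n ->
  coefL F n (a :: s) = wchain a s.
Proof. by move=> a0 sn; apply: val_inj; rewrite val_wchain // sn val_coefL. Qed.

(** Sorting the exponents by their head b.+1: A_n is the sum of the parts of
    degree n of [n] f_0^a / [a], 1 <= a <= n. *)
Lemma A_E n N m : (2 * N - 2)%N = m.+1 ->
  A_ F n N = \sum_(b < n) flog F m 0 b.+1 (n - b.+1).
Proof.
move=> Nm; rewrite /A_.
have E (l : nat) : l = m.+1 ->
    \sum_(s : l.-tuple 'I_n.+1 | (0 < head 0 (exps s))%N && (sumn (exps s) == n))
      coefL F n (exps s) *: monomA F (exps s) =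
    \sum_(b < n) flog F m 0 b.+1 (n - b.+1).
  move=> ->; rewrite big_mkcondl.
  rewrite (sum_tupleS m (fun s => if (0 < head 0 s)%N then
    coefL F n s *: monomA F s else 0) (leqnn n)).
  rewrite big_ord_recl big1 // add0r; apply: eq_bigr => b _.
  rewrite -(sum_wchain (n := n)) ?leq_subr //; apply: eq_bigr => s /eqP sn.
  rewrite /= coefL_wchain ?monomA_u //.
  by rewrite sn /= /bump; have := ltn_ord b; lia.
by rewrite -(E _ Nm); apply: eq_bigl => s; rewrite inE.
Qed.

End TupleSums.

(** * The conservation laws *)

Section Conservation.
Variables (F : fieldType) (n N : nat).
Hypotheses (n1 : (1 <= n)%N) (nN : (n <= 2 * (N - 1))%N).
Local Notation q := (qL F).
Local Notation u := (@u_ F).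
Local Notation z := (@z_ F).

(** V_+(A_n) is a telescoping sum equal to (q-1) [n] times the part of degree n of
    f_0, times z_0; as u_0 z_0 = z_1^-1, it is (q-1) [n] z_1^-1 times a part of
    sum_b f_1^b, which is what V_+(B_n) contributes with the opposite sign. *)
Lemma Vplus_A_B : Vplus (A_ F n N) + Vplus (B_ F n N) = 0.
Proof.
have [m Nm] : exists m, (2 * N - 2)%N = m.+1 by exists (2 * N - 3)%N; lia.
have VS k : Vplus (\sum_(b < n) flog F m k b.+1 (n - b.+1)) =
    qint F n *: \sum_(b < n) fder F m k b.+1 (n - b.+1).
  rewrite Vplus_sum => [|b]; last exact: Aq0_flog.
  rewrite scaler_sumr; apply: eq_bigr => b _.
  by rewrite Vplus_flog subnKC.
rewrite /B_ (A_E F n Nm) raddf_sum VS.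
under [X in Vplus X]eq_bigr do rewrite /= Thalf_flog.
rewrite VS -scalerDr.
(* the part of degree n of f_0^(b+1), extended by 0 *)
pose p b := if (b < n)%N then fpow F m 0 b.+1 (n - b.+1) else 0.
have fder0 (b : 'I_n) : fder F m 0 b.+1 (n - b.+1) =
    (q - 1) *: ((p b - p b.+1) * z 0).
  have := @fderE F m 0 b.+1 (n - b.+1); rewrite /fder_spec /= => ->; last by lia.
  congr (_ *: ((_ - _) * _)); rewrite /p; first by rewrite ltn_ord.
  case: ltnP => bn; first by rewrite (_ : n - b.+1 = (n - b.+2).+1)%N //; lia.
  by rewrite (_ : n - b.+1 = 0)%N //; lia.
have fder1 (b : 'I_n) : fder F m 1 b.+1 (n - b.+1) =
    (1 - q) *: ((z 1)^-1 * fpow F m 1 b (n - b.+1)).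
  by have := @fderE F m 1 b (n - b.+1); rewrite /fder_spec /= => ->; last by lia.
under eq_bigr do rewrite fder0.
under [X in _ + X]eq_bigr do rewrite fder1.
rewrite -!scaler_sumr -mulr_suml -mulr_sumr -[q - 1]opprB scaleNr.
have -> : \sum_(b < n) (p b - p b.+1) = fpow F m 0 1 (n - 1).
  rewrite -(big_mkord xpredT (fun b => p b - p b.+1)).
  under eq_bigr do rewrite -opprB.
  by rewrite sumrN telescope_sumr // opprB /p ltnn n1 subr0.
rewrite [fpow F m 0 1 _]/fpow expr1 -mulrA -z_ftail mulrA u_z.
case: n n1 nN Nm => // n' _ n'N Nm'.
(* A_n contains u_1, ..., u_m only, and B_n also u_(m+1), which does not occur in
   the part of degree n - 1 of sum_b f_1^b. *)
rewrite subSS subn0 -ftail_stable ?ftailS; last by lia.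
under eq_bigr do rewrite qmulti_1n scale1r -subSS.
by rewrite addNr scaler0.
Qed.

Lemma Aq0_psi : Aq0 (psi_ F n N).
Proof. by apply: Aq0D; [|apply: Aq0_Thalf]; apply: Aq0_A. Qed.

Lemma Vplus_psi : Vplus (psi_ F n N) = 0.
Proof. by rewrite /psi_ VplusD ?Vplus_A_B //; [|apply: Aq0_Thalf]; apply: Aq0_A. Qed.

Lemma Vminus_psi : Vminus (psi_ F n N) =
  - (T (Vminus (A_ F n N)) - Vminus (A_ F n N)).
Proof.
have A0 := Aq0_A F n N; rewrite opprB.
rewrite /psi_ VminusD //; last exact: Aq0_Thalf.
congr (_ + _); rewrite Vminus_Thalf // -ThalfK -Vplus_Thalf // -raddfN.
by congr Thalf; apply/eqP; rewrite -addr_eq0; apply/eqP/Vplus_A_B.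
Qed.

End Conservation.

Local Open Scope complex_scope.

Theorem mainTheorem1 (R : realType) (n N : nat)
    (n_ge1 : (1 <= n)%N) (n_le : (n <= 2 * (N - 1))%N) :
  is_density (psi_ R[i] n N) /\
  Vplus (psi_ R[i] n N) = 0 /\
  Vminus (psi_ R[i] n N) =
    - (T (Vminus (A_ R[i] n N)) - Vminus (A_ R[i] n N)).
Proof.
have Vp := Vplus_psi R[i] n_ge1 n_le; have Vm := Vminus_psi R[i] n_ge1 n_le.
split; last by split.
split; first exact: Aq0_psi.
- by rewrite Vp; exists 0 => //; rewrite raddf0 subrr.
- rewrite Vm; exists (- Vminus (A_ R[i] n N)) => //.
  by rewrite raddfN /= opprB opprK addrC.
Qed.
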